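(* Let $A\in\mathbb{R}^{m\times n}$, $b\in\mathbb{R}^m$, $c\in\mathbb{R}^n$ be LP data satisfying the Assumption in the context, and suppose $c\in\operatorname{Null}(A)$. Run Algorithm rPDHG (see context) starting from $z^{0,0}=(x^{0,0},y^{0,0})=(0,0)$ with the $\beta$-restart condition, $\beta:=1/e$ ($e$ the base of the natural logarithm), and step-sizes $$\tau=\frac{\mu_d\|q\|}{2\kappa\mu_p\|c\|},\qquad \sigma=\frac{\mu_p\|c\|}{2\mu_d\|q\|\lambda_{\max}\lambda_{\min}} .$$ Let $\varepsilon>0$, and let $T$ be the total number of PDHGstep iterations that are run in order to obtain $n$ for which $(x^{n,0},s^{n,0})$ satisfies $\mathcal{E}_d(x^{n,0},s^{n,0})\le\varepsilon$, where $s^{n,0}:=c-A^\top y^{n,0}$. Then $$T\ \le\ 5e\cdot\widehat{\mathcal{N}}\cdot\ln\left(\widehat{\mathcal{N}}\,\widehat{\mathcal{D}}\cdot\frac{\mathcal{E}_d(x^{0,0},s^{0,0})}{\varepsilon}\right)+1,$$ where $$\widehat{\mathcal{N}}:=16\,\kappa\left(\frac{\theta_p^\star}{\mu_p}+\frac{\theta_d^\star}{\mu_d}+\frac{\operatorname{Dist}(0,\mathcal{X}^\star)}{\mu_d\cdot\operatorname{Dist}(0,V_p)}+\frac{\operatorname{Dist}(c,\mathcal{S}^\star)}{\mu_p\cdot\operatorname{Dist}(0,V_d)}\right),\qquad \widehat{\mathcal{D}}:=32e\cdot\kappa\cdot\max\left\{\frac{\mu_p\|c\|}{\mu_d\|b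\|_Q},\frac{\mu_d\|b\|_Q}{\mu_p\|c\|}\right\}.$$
   Context: All norms are Euclidean unless indicated; $\operatorname{Dist}(v,\mathcal V)$ is Euclidean distance to a set. LP setting. Primal: $\min c^\top x$ s.t. $Ax=b,\ x\ge0$. Dual: $\max b^\top y$ s.t. $A^\top y+s=c,\ s\ge0$. Put $q:=A^\top(AA^\top)^\dagger b$ ($\dagger$ = Moore–Penrose inverse) and $\|b\|_Q:=\|A^\top(AA^\top)^\dagger b\|=\|q\|$, $V_p:=\{x:Ax=b\}$, $V_d:=c+\operatorname{Im}(A^\top)$, $\mathcal{F}_p:=V_p\cap\mathbb{R}^n_+$, $\mathcal{F}_d:=V_d\cap\mathbb{R}^n_+$. In terms of slacks the dual is $\max q^\top(c-s)$ s.t. $s\in\mathcal{F}_d$. $\mathcal{X}^\star,\mathcal{Y}^\star,\mathcal{S}^\star$ are the sets of optimal $x$, $y$, $s$; $\mathcal{Z}^\star:=\mathcal{X}^\star\times\mathcal{Y}^\star$ is the set of saddlepoints of $L(x,y):=c^\top x+b^\top y-x^\top A^\top y$ over $x\in\mathbb{R}^n_+$ (min), $y\in\mathbb{R}^m$ (max). Assumption: the primal has an optimal solution, and non-optimal feasible solutions exist for both the primal and the dual (equivalently, for the primal in $x$ and the dual in the slack variable $s$). $\lambda_{\max},\lambda_{\min}$ are the largest and smallest nonzero singular values of $A$, and $\kappa:=\lambda_{\max}/\lambda_{\min}$. Limiting error ratios: $\theta_p(x):=\operatorname{Dist}(x,\mathcal{F}_p)/\operatorname{Dist}(x,\mathbb{R}^n_+)$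 for $x\in V_p\setminus\mathcal{F}_p$ and $\theta_p(x):=1$ for $x\in\mathcal{F}_p$; $\theta_p^\star:=\lim_{\epsilon\to0}\sup\{\theta_p(x):x\in V_p,\ \operatorname{Dist}(x,\mathcal{X}^\star)\le\epsilon\}$. Similarly $\theta_d(s)$ and $\theta_d^\star$ are defined with $V_d,\mathcal{F}_d,\mathcal{S}^\star$ in place of $V_p,\mathcal{F}_p,\mathcal{X}^\star$. LP sharpness: $\mu_p:=\inf_{x\in\mathcal{F}_p\setminus\mathcal{X}^\star}\operatorname{Dist}(x,V_p\cap H_p^\star)/\operatorname{Dist}(x,\mathcal{X}^\star)$ with $H_p^\star:=\{\hat x\in\mathbb{R}^n:c^\top\hat x=c^\top x^\star\}$, $x^\star\in\mathcal{X}^\star$; $\mu_d:=\inf_{s\in\mathcal{F}_d\setminus\mathcal{S}^\star}\operatorname{Dist}(s,V_d\cap H_d^\star)/\operatorname{Dist}(s,\mathcal{S}^\star)$ with $H_d^\star:=\{\hat s\in\mathbb{R}^n:q^\top(c-\hat s)=q^\top(c-s^\star)\}$, $s^\star\in\mathcal{S}^\star$. Distance to optima: $\mathcal{E}_d(x,s):=\max\{\operatorname{Dist}(x,\mathcal{X}^\star),\operatorname{Dist}(s,\mathcal{S}^\star)\}$. PDHGstep with step-sizes $\tau,\sigma$: from $z=(x,y)$ produce $z^+=(x^+,y^+)$ with $x^+:=P_{\mathbb{R}^n_+}(x-\tau(c-A^\top y))$, $y^+:=y+\sigma(b-A(2x^+-x))$, where $P_{\mathbb{R}^n_+}$ is Euclidean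 projection. $M:=\begin{pmatrix}\frac1\tau I_n&-A^\top\\-A&\frac1\sigma I_m\end{pmatrix}$, $\|z\|_M:=\sqrt{z^\top Mz}$. Normalized duality gap: for $z=(x,y)\in\mathbb{R}^n_+\times\mathbb{R}^m$ and $r>0$, $\rho(r;z):=\frac1r\max\{L(x,\hat y)-L(\hat x,y):\hat x\ge0,\ \|(\hat x,\hat y)-z\|_M\le r\}$. Algorithm rPDHG. Start with $z^{0,0}$, $n=0$. Outer loop $n$: set $k=0$; repeat $z^{n,k+1}:=\text{PDHGstep}(z^{n,k})$, $\bar z^{n,k+1}:=\frac1{k+1}\sum_{i=1}^{k+1}z^{n,i}$, $k:=k+1$, until $(n,k)$ satisfies the restart condition; then set $z^{n+1,0}:=\bar z^{n,k}$, $n:=n+1$. Stop if $z^{n,0}$ is a saddlepoint (or another convergence condition holds). The $\beta$-restart condition holds at $(n,k)$ if either $n=0$ and $k=1$, or $n\ge1$ and $\rho(\|\bar z^{n,k}-z^{n,0}\|_M;\bar z^{n,k})\le\beta\cdot\rho(\|z^{n,0}-z^{n-1,0}\|_M;z^{n,0})$. Write $z^{n,k}=(x^{n,k},y^{n,k})$.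
   Formalization: The bound on T is stated as the maximum of 0 and the printed right-hand side, because for very large ε the printed right-hand side is negative while T = 0; wherever the printed right-hand side is nonnegative the bound is the one stated. *)

(* Defs.v *)
From HB Require Import structures.
From mathcomp Require Import all_boot all_order all_algebra.
From mathcomp Require Import boolp classical_sets reals topology normedtype.
From mathcomp Require Import sequences exp.

Set Implicit Arguments.
Unset Strict Implicit.
Unset Printing Implicit Defensive.

Import Order.TTheory GRing.Theory Num.Theory.
Import numFieldNormedType.Exports.
Local Open Scope classical_set_scope.
Local Open Scope ring_scope.

Definition dot {R : realType} {n : nat} (u v : 'cV[R]_n) : R :=
  \sum_i u i 0 * v i 0.

(* Not the library norm `|v|, which on matrices is the sup norm. *)
Definition enorm {R : realType} {n : nat} (v : 'cV[R]_n) : R :=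
  Num.sqrt (dot v v).

(* Only meaningful for nonempty V: inf set0 = 0. *)
Definition Dist {R : realType} {n : nat} (v : 'cV[R]_n) (V : set 'cV[R]_n) : R :=
  inf [set enorm (v - u) | u in V].

Definition orthant {R : realType} {n : nat} : set 'cV[R]_n :=
  [set x | forall i, 0 <= x i 0].

Definition eproj {R : realType} {n : nat} (K : set 'cV[R]_n) (v : 'cV[R]_n) :
    'cV[R]_n :=
  xget v [set p | K p /\ forall u, K u -> enorm (v - p) <= enorm (v - u)].

Definition is_pinv {R : realType} {m n : nat} (A : 'M[R]_(m, n))
    (P : 'M[R]_(n, m)) : Prop :=
  [/\ A *m P *m A = A, P *m A *m P = P,
      (A *m P)^T = A *m P & (P *m A)^T = P *m A].

Definition pinv {R : realType} {m n : nat} (A : 'M[R]_(m, n)) : 'M[R]_(n, m) :=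
  xget 0 [set P | is_pinv A P].

Definition nonzero_singular_values {R : realType} {m n : nat}
    (A : 'M[R]_(m, n)) : set R :=
  [set l | 0 < l /\ eigenvalue (A^T *m A) (l ^+ 2)].

(* The set of singular values is finite, and nonempty when A != 0. *)
Definition lambda_max {R : realType} {m n : nat} (A : 'M[R]_(m, n)) : R :=
  sup (nonzero_singular_values A).

Definition lambda_min {R : realType} {m n : nat} (A : 'M[R]_(m, n)) : R :=
  inf (nonzero_singular_values A).

Definition kappa {R : realType} {m n : nat} (A : 'M[R]_(m, n)) : R :=
  lambda_max A / lambda_min A.

Section LP.
Context {R : realType} {m n : nat}.
Implicit Types (A : 'M[R]_(m, n)) (b : 'cV[R]_m) (c x s : 'cV[R]_n).
Implicit Types (V Opt : set 'cV[R]_n).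

Definition qvec A b : 'cV[R]_n := A^T *m pinv (A *m A^T) *m b.

Definition normQ A b : R := enorm (qvec A b).

Definition Vp A b : set 'cV[R]_n := [set x | A *m x = b].

Definition Vd A c : set 'cV[R]_n := [set c + A^T *m y | y in [set: 'cV[R]_m]].

Definition Fp A b : set 'cV[R]_n := Vp A b `&` orthant.

Definition Fd A c : set 'cV[R]_n := Vd A c `&` orthant.

Definition Xstar A b c : set 'cV[R]_n :=
  [set x | Fp A b x /\ forall x', Fp A b x' -> dot c x <= dot c x'].

Definition Sstar A b c : set 'cV[R]_n :=
  [set s | Fd A c s /\ forall s', Fd A c s' ->
     dot (qvec A b) (c - s') <= dot (qvec A b) (c - s)].

Definition LP_assumption A b c : Prop :=
  [/\ Xstar A b c !=set0,
      exists x, Fp A b x /\ ~ Xstar A b c x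
    & exists s, Fd A c s /\ ~ Sstar A b c s].

Definition error_ratio V x : R :=
  if `[< (V `&` orthant) x >] then 1
  else Dist x (V `&` orthant) / Dist x (orthant).

Definition limiting_error_ratio V Opt : R :=
  lim (sup [set error_ratio V x | x in V `&` [set x | Dist x Opt <= eps]]
       @[eps --> 0^'+]).

Definition theta_p A b c : R := limiting_error_ratio (Vp A b) (Xstar A b c).

Definition theta_d A b c : R := limiting_error_ratio (Vd A c) (Sstar A b c).

Definition Hp A b c : set 'cV[R]_n :=
  [set x | exists2 xs, Xstar A b c xs & dot c x = dot c xs].

Definition Hd A b c : set 'cV[R]_n :=
  [set s | exists2 ss, Sstar A b c ss &
     dot (qvec A b) (c - s) = dot (qvec A b) (c - ss)].

Definition mu_p A b c : R :=
  inf [set Dist x (Vp A b `&` Hp A b c) / Dist x (Xstar A b c)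
      | x in Fp A b `\` Xstar A b c].

Definition mu_d A b c : R :=
  inf [set Dist s (Vd A c `&` Hd A b c) / Dist s (Sstar A b c)
      | s in Fd A c `\` Sstar A b c].

Definition Ed A b c x s : R :=
  Num.max (Dist x (Xstar A b c)) (Dist s (Sstar A b c)).

Definition pdhg_step A b c (tau sigma : R) (z : 'cV[R]_n * 'cV[R]_m) :
    'cV[R]_n * 'cV[R]_m :=
  let xp := eproj (orthant) (z.1 - tau *: (c - A^T *m z.2)) in
  (xp, z.2 + sigma *: (b - A *m (2 *: xp - z.1))).

Definition Lagrangian A b c x (y : 'cV[R]_m) : R :=
  dot c x + dot b y - dot x (A^T *m y).

Definition Mmx A (tau sigma : R) : 'M[R]_(n + m) :=
  block_mx (tau^-1)%:M (- A^T) (- A) (sigma^-1)%:M.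

Definition normM A (tau sigma : R) (z : 'cV[R]_n * 'cV[R]_m) : R :=
  Num.sqrt (dot (col_mx z.1 z.2) (Mmx A tau sigma *m col_mx z.1 z.2)).

(* Only meaningful for 0 < r: here r^-1 = 0 when r = 0.  In rPDHG a zero
   radius occurs only once a restart point is a saddlepoint, i.e. after the
   algorithm has stopped. *)
Definition rho A b c (tau sigma : R) (r : R) (z : 'cV[R]_n * 'cV[R]_m) : R :=
  r^-1 * sup [set Lagrangian A b c z.1 zh.2 - Lagrangian A b c zh.1 z.2
             | zh in [set zh | orthant zh.1
                               /\ normM A tau sigma (zh - z) <= r]].

Definition pdhg_avg A b c (tau sigma : R) (z : 'cV[R]_n * 'cV[R]_m) (k : nat) :
    'cV[R]_n * 'cV[R]_m :=
  k%:R^-1 *: \sum_(1 <= i < k.+1) iter i (pdhg_step A b c tau sigma) z.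

(* ks j is the number of PDHG steps of the j-th outer loop; the result is the
   j-th restart point z^{j,0} of rPDHG. *)
Fixpoint restart_point A b c (tau sigma : R) (z0 : 'cV[R]_n * 'cV[R]_m)
    (ks : nat -> nat) (j : nat) : 'cV[R]_n * 'cV[R]_m :=
  if j is j'.+1 then
    pdhg_avg A b c tau sigma (restart_point A b c tau sigma z0 ks j') (ks j')
  else z0.

Definition restart_condition A b c (tau sigma beta : R)
    (z0 : 'cV[R]_n * 'cV[R]_m) (ks : nat -> nat) (j k : nat) : Prop :=
  let z := restart_point A b c tau sigma z0 ks in
  let zbar := pdhg_avg A b c tau sigma (z j) k in
  (j = 0 /\ k = 1)%N \/
  (0 < j)%N /\
    rho A b c tau sigma (normM A tau sigma (zbar - z j)) zbar
    <= beta * rho A b c tau sigma (normM A tau sigma (z j - z j.-1)) (z j).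

(* The first N outer loops of rPDHG all terminate, the j-th one after exactly
   ks j PDHG steps; this determines ks on [0, N). *)
Definition rPDHG_run A b c (tau sigma beta : R) (z0 : 'cV[R]_n * 'cV[R]_m)
    (ks : nat -> nat) (N : nat) : Prop :=
  forall j, (j < N)%N ->
    [/\ (0 < ks j)%N,
        restart_condition A b c tau sigma beta z0 ks j (ks j)
      & forall k, (0 < k < ks j)%N ->
          ~ restart_condition A b c tau sigma beta z0 ks j k].

Definition restart_error A b c (tau sigma : R) (z0 : 'cV[R]_n * 'cV[R]_m)
    (ks : nat -> nat) (j : nat) : R :=
  let z := restart_point A b c tau sigma z0 ks j in
  Ed A b c z.1 (c - A^T *m z.2).

(* T PDHG steps are run until the first restart point with error at most eps. *)
Definition rPDHG_iterations A b c (tau sigma beta : R)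
    (z0 : 'cV[R]_n * 'cV[R]_m) (eps : R) (T : nat) : Prop :=
  exists (ks : nat -> nat) (N : nat),
    [/\ rPDHG_run A b c tau sigma beta z0 ks N,
        restart_error A b c tau sigma z0 ks N <= eps,
        forall j, (j < N)%N -> eps < restart_error A b c tau sigma z0 ks j
      & T = (\sum_(j < N) ks j)%N].

Definition tau_step A b c : R :=
  mu_d A b c * enorm (qvec A b) / (2 * kappa A * mu_p A b c * enorm c).

Definition sigma_step A b c : R :=
  mu_p A b c * enorm c
  / (2 * mu_d A b c * enorm (qvec A b) * lambda_max A * lambda_min A).

Definition Nhat A b c : R :=
  16 * kappa A *
  (theta_p A b c / mu_p A b c + theta_d A b c / mu_d A b c
   + Dist 0 (Xstar A b c) / (mu_d A b c * Dist 0 (Vp A b))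
   + Dist c (Sstar A b c) / (mu_p A b c * Dist 0 (Vd A c))).

Definition Dhat A b c : R :=
  32 * expR 1 * kappa A *
  Num.max (mu_p A b c * enorm c / (mu_d A b c * normQ A b))
          (mu_d A b c * normQ A b / (mu_p A b c * enorm c)).

End LP.

(* Main.v *)
Require Import Defs.
From mathcomp Require Import all_boot all_order all_algebra.
From mathcomp Require Import ring lra.
From mathcomp Require Import boolp classical_sets reals topology normedtype.
From mathcomp Require Import sequences exp derive realfun.

(** The iterates are driven by two opposite estimates of the normalized gap at the
    restart points.

    Decay.  In the norm of [Mform tau sigma (- A)] each step is Fejer monotone with
    respect to saddle points, and the gap of the average of [k] steps decays like
    [D / k], where [D] is the distance of the first point to a saddle point
    (rho_avg_le).  The normalized gap itself uses balls of [normM A], whose coupling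
    term has the other sign; the step sizes make the two norms comparable up to
    [sqrt 3], which the constants absorb.

    Sharpness.  A normalized gap [rh] at [z = (x, y)] bounds three things by [rh]:
    the residual of [A x = b], the negative part of the reduced cost
    [s = c - A^T y], and the objective errors of [x] and [s], the latter two being
    dominated by the gaps towards the points [(x0, 0)] and [(0, y0)] built from
    optima.  For a single
    linear program whose objective is parallel to its affine space, infeasibility
    and objective error bound the distance to the optimal set with the constants
    [theta] and [mu] (LP_error_bound): the estimate holds near the optimal set by
    definition and extends to all points by sliding towards the closest optimum.
    The dual program in [s] is of the same shape, so one lemma serves both.  Since
    [c] is in the null space of [A], restoring [A x = b] does not change the
    objective.  With the prescribed step sizes all the resulting terms are
    multiples of the terms of [Nhat] (saddle_distance, error_distance).

    Together, a cycle needs at most a constant times [kappa * condition_sum] steps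
    before the gap has shrunk by the factor [1 / e] (restart_length), and the error
    at the restart points decreases geometrically, which bounds the number of
    cycles by a logarithm (pending_bound).

    That [mu] is positive and [theta] finite rests on Hoffman's error bound
    (hoffman_bound), and that optimal dual solutions exist on Farkas' lemma; both
    come from the finite generation of the cone of nonnegative vectors in the kernel
    of a matrix (orthant_kernel_cone). *)

Set Implicit Arguments.
Unset Strict Implicit.
Unset Printing Implicit Defensive.

Import Order.TTheory GRing.Theory Num.Theory.
Import numFieldNormedType.Exports.
Local Open Scope classical_set_scope.
Local Open Scope ring_scope.

(** * Positive semidefinite bilinear forms and their seminorms *)
Section PsdForm.
Context {R : realType} {V : lmodType R}.
Implicit Types (f : V -> V -> R).

(** The instances are the Euclidean inner product and the two step-size forms on
    pairs, those of [A] and of [- A]. *)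
Definition psd_form f : Prop :=
  [/\ forall u v w, f (u + v) w = f u w + f v w,
      forall a u w, f (a *: u) w = a * f u w,
      forall u v, f u v = f v u
    & forall u, 0 <= f u u].

Definition snorm f u : R := Num.sqrt (f u u).

Section PsdFormTheory.
Context (f : V -> V -> R) (hf : psd_form f).

Lemma formDl u v w : f (u + v) w = f u w + f v w.
Proof. by case: hf. Qed.

Lemma formZl a u w : f (a *: u) w = a * f u w.
Proof. by case: hf. Qed.

Lemma formC u v : f u v = f v u.
Proof. by case: hf. Qed.

Lemma form_ge0 u : 0 <= f u u.
Proof. by case: hf. Qed.

Lemma formDr u v w : f u (v + w) = f u v + f u w.
Proof. by rewrite !(formC u) formDl. Qed.

Lemma formZr a u w : f u (a *: w) = a * f u w.
Proof. by rewrite !(formC u) formZl. Qed.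

Lemma formNl u w : f (- u) w = - f u w.
Proof. by rewrite -scaleN1r formZl mulN1r. Qed.

Lemma formNr u w : f u (- w) = - f u w.
Proof. by rewrite !(formC u) formNl. Qed.

Lemma formBl u v w : f (u - v) w = f u w - f v w.
Proof. by rewrite formDl formNl. Qed.

Lemma formBr u v w : f u (v - w) = f u v - f u w.
Proof. by rewrite formDr formNr. Qed.

Lemma form0l w : f 0 w = 0.
Proof. by rewrite -(scale0r 0) formZl mul0r. Qed.

Lemma form0r w : f w 0 = 0.
Proof. by rewrite formC form0l. Qed.

Lemma snorm_ge0 u : 0 <= snorm f u.
Proof. exact: sqrtr_ge0. Qed.

Lemma sqr_snorm u : snorm f u ^+ 2 = f u u.
Proof. by rewrite sqr_sqrtr ?form_ge0. Qed.

Lemma snorm0 : snorm f 0 = 0.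
Proof. by rewrite /snorm form0l sqrtr0. Qed.

Lemma snormZ a u : snorm f (a *: u) = `|a| * snorm f u.
Proof.
by rewrite /snorm formZl formZr mulrA -expr2 sqrtrM ?sqr_ge0 // sqrtr_sqr.
Qed.

Lemma snormN u : snorm f (- u) = snorm f u.
Proof. by rewrite /snorm formNl formNr opprK. Qed.

Lemma snormB u v : snorm f (u - v) = snorm f (v - u).
Proof. by rewrite -snormN opprB. Qed.

Lemma form_sqrD u v t :
  f (u + t *: v) (u + t *: v) = f u u + 2 * t * f u v + t ^+ 2 * f v v.
Proof. by rewrite !(formDl, formDr, formZl, formZr) (formC v u); ring. Qed.

Lemma form_CS u v : f u v <= snorm f u * snorm f v.
Proof.
have hsq : f u v ^+ 2 <= f u u * f v v.
  have h t : 0 <= f u u + 2 * t * f u v + t ^+ 2 * f v v.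
    by rewrite -form_sqrD form_ge0.
  have := form_ge0 v; rewrite le_eqVlt => /orP[/eqP d0|d0].
    have [->|b0] := eqVneq (f u v) 0; first by rewrite -d0 expr0n mulr0.
    have := h (- (f u u + 1) / (2 * f u v)); rewrite -d0.
    by rewrite (_ : _ + _ = - 1); [lra|field].
  have := h (- f u v / f v v).
  rewrite (_ : _ + _ = (f u u * f v v - f u v ^+ 2) / f v v); last first.
    by field; rewrite gt_eqF.
  by rewrite pmulr_lge0 ?invr_gt0 // subr_ge0.
apply: le_trans (ler_norm _) _.
rewrite -(@ler_pXn2r _ 2) ?nnegrE ?mulr_ge0 ?snorm_ge0 ?normr_ge0 //.
by rewrite real_normK ?num_real // exprMn !sqr_snorm.
Qed.

Lemma form_CS_norm u v : `|f u v| <= snorm f u * snorm f v.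
Proof.
by rewrite ler_norml form_CS andbT lerNl -formNl -[snorm f u]snormN form_CS.
Qed.

Lemma snormD u v : snorm f (u + v) <= snorm f u + snorm f v.
Proof.
rewrite -(@ler_pXn2r _ 2) ?nnegrE ?addr_ge0 ?snorm_ge0 //.
rewrite sqrrD !sqr_snorm formDl !formDr (formC v u).
have := form_CS u v; lra.
Qed.

Lemma snorm_triangle u v w : snorm f (u - w) <= snorm f (u - v) + snorm f (v - w).
Proof. by rewrite -[u in leLHS](subrK v) -addrA snormD. Qed.

(** The three-point identity: it turns the inner product in the optimality
    condition of a proximal step into telescoping squared distances. *)
Lemma form_polar u v w :
  2 * f (u - v) (w - u) =
  f (w - v) (w - v) - f (w - u) (w - u) - f (u - v) (u - v).
Proof. by rewrite !(formBl, formBr) (formC v u) (formC w u) (formC w v); ring. Qed.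

End PsdFormTheory.
End PsdForm.

(** * Euclidean norm and distance to a set *)
Section Euclidean.
Context {R : realType}.

Lemma dot_psd n : psd_form (@dot R n).
Proof.
split=> [u v w|a u w|u v|u].
- by rewrite /dot -big_split; apply: eq_bigr => i _; rewrite mxE mulrDl.
- by rewrite /dot mulr_sumr; apply: eq_bigr => i _; rewrite mxE mulrA.
- by apply: eq_bigr => i _; rewrite mulrC.
- by apply: sumr_ge0 => i _; rewrite -expr2 sqr_ge0.
Qed.

Lemma dotE n (u v : 'cV[R]_n) : dot u v = (u^T *m v) 0 0.
Proof. by rewrite mxE; apply: eq_bigr => i _; rewrite mxE. Qed.

Lemma dot_mulmx m n (A : 'M[R]_(m, n)) u v : dot (A *m u) v = dot u (A^T *m v).
Proof. by rewrite !dotE trmx_mul mulmxA. Qed.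

Lemma dot_col_mx m n (u u' : 'cV[R]_m) (v v' : 'cV[R]_n) :
  dot (col_mx u v) (col_mx u' v') = dot u u' + dot v v'.
Proof.
rewrite /dot big_split_ord /=; congr (_ + _); apply: eq_bigr => i _.
  by rewrite !col_mxEu.
by rewrite !col_mxEd.
Qed.

Lemma dot_eq0 n (u : 'cV[R]_n) : dot u u = 0 -> u = 0.
Proof.
move=> /eqP; rewrite psumr_eq0 => [|i _]; last by rewrite -expr2 sqr_ge0.
move=> /allP h; apply/colP => i; rewrite mxE.
by have := h i (mem_index_enum i); rewrite -expr2 sqrf_eq0 => /eqP.
Qed.

Lemma dot_ge0 n (u v : 'cV[R]_n) : orthant u -> orthant v -> 0 <= dot u v.
Proof. by move=> hu hv; apply: sumr_ge0 => i _; rewrite mulr_ge0. Qed.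

Lemma enorm_ge0 n (u : 'cV[R]_n) : 0 <= enorm u.
Proof. exact: snorm_ge0. Qed.

Lemma enormE n (u : 'cV[R]_n) : enorm u ^+ 2 = dot u u.
Proof. exact: (sqr_snorm (dot_psd n)). Qed.

Lemma enorm_gt0 n (u : 'cV[R]_n) : u != 0 -> 0 < enorm u.
Proof.
move=> u0; rewrite lt_def enorm_ge0 andbT; apply: contra u0 => /eqP h.
by apply/eqP/dot_eq0; rewrite -enormE h expr0n.
Qed.

Lemma enorm_gt0_dot n (u : 'cV[R]_n) : u != 0 -> 0 < dot u u.
Proof. by move=> u0; rewrite -enormE exprn_gt0 // enorm_gt0. Qed.

Lemma enormZ n a (u : 'cV[R]_n) : enorm (a *: u) = `|a| * enorm u.
Proof. exact: (snormZ (dot_psd n)). Qed.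

Lemma enormN n (u : 'cV[R]_n) : enorm (- u) = enorm u.
Proof. exact: (snormN (dot_psd n)). Qed.

Lemma enormB n (u v : 'cV[R]_n) : enorm (u - v) = enorm (v - u).
Proof. exact: (snormB (dot_psd n)). Qed.

Lemma enormD n (u v : 'cV[R]_n) : enorm (u + v) <= enorm u + enorm v.
Proof. exact: (snormD (dot_psd n)). Qed.

Lemma enorm_triangle n (u v w : 'cV[R]_n) :
  enorm (u - w) <= enorm (u - v) + enorm (v - w).
Proof. exact: (snorm_triangle (dot_psd n)). Qed.

Lemma dot_CS n (u v : 'cV[R]_n) : dot u v <= enorm u * enorm v.
Proof. exact: (form_CS (dot_psd n)). Qed.

Lemma dot_CS_norm n (u v : 'cV[R]_n) : `|dot u v| <= enorm u * enorm v.
Proof. exact: (form_CS_norm (dot_psd n)). Qed.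

Lemma enorm_le_sqr n (u v : 'cV[R]_n) : (enorm u <= enorm v) = (dot u u <= dot v v).
Proof. by rewrite -!enormE ler_pXn2r ?nnegrE ?enorm_ge0. Qed.

Lemma coord_le_enorm n (u : 'cV[R]_n) i : `|u i 0| <= enorm u.
Proof.
rewrite -(@ler_pXn2r _ 2) ?nnegrE ?enorm_ge0 ?normr_ge0 // enormE.
rewrite real_normK ?num_real // /dot (bigD1 i) //= -expr2 lerDl.
by apply: sumr_ge0 => j _; rewrite -expr2 sqr_ge0.
Qed.

Lemma enorm_sum n (I : finType) (F : I -> 'cV[R]_n) :
  enorm (\sum_i F i) <= \sum_i enorm (F i).
Proof.
elim/big_ind2 : _ => [|x1 x2 y1 y2 h1 h2|//].
  by rewrite [leLHS](snorm0 (dot_psd n)).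
by apply: le_trans (enormD _ _) _; rewrite lerD.
Qed.

Lemma Dist_le n (v u : 'cV[R]_n) (V : set 'cV[R]_n) : V u -> Dist v V <= enorm (v - u).
Proof.
move=> hu; apply: ge_inf; last by exists u.
by exists 0 => _ [w _ <-]; exact: enorm_ge0.
Qed.

Lemma Dist_ge n (v : 'cV[R]_n) (V : set 'cV[R]_n) a :
  V !=set0 -> (forall u, V u -> a <= enorm (v - u)) -> a <= Dist v V.
Proof.
move=> [u0 hu0] h; apply: lb_le_inf; first by exists (enorm (v - u0)), u0.
by move=> _ [w hw <-]; exact: h.
Qed.

Lemma Dist_ge0 n (v : 'cV[R]_n) (V : set 'cV[R]_n) : 0 <= Dist v V.
Proof.
have [->|/set0P V0] := eqVneq V set0; first by rewrite /Dist image_set0 inf0.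
by apply: Dist_ge => // u _; exact: enorm_ge0.
Qed.

Lemma Dist_eq n (v u : 'cV[R]_n) (V : set 'cV[R]_n) :
  V u -> (forall w, V w -> enorm (v - u) <= enorm (v - w)) ->
  Dist v V = enorm (v - u).
Proof.
by move=> hu h; apply/le_anti; rewrite Dist_le //= Dist_ge //; exists u.
Qed.

Lemma Dist_triangle n (v w : 'cV[R]_n) (V : set 'cV[R]_n) :
  V !=set0 -> Dist v V <= enorm (v - w) + Dist w V.
Proof.
move=> V0; rewrite -lerBlDl; apply: Dist_ge => // u hu.
by rewrite lerBlDl; apply: le_trans (Dist_le v hu) (enorm_triangle _ _ _).
Qed.

End Euclidean.

(** * Finite generation of polyhedral cones *)
Section Cones.
Context {R : realType}.

Lemma orthantD n (u v : 'cV[R]_n) : orthant u -> orthant v -> orthant (u + v).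
Proof. by move=> hu hv i; rewrite mxE addr_ge0. Qed.

Lemma orthantZ n a (u : 'cV[R]_n) : 0 <= a -> orthant u -> orthant (a *: u).
Proof. by move=> ha hu i; rewrite mxE mulr_ge0. Qed.

Lemma orthant0 n : orthant (0 : 'cV[R]_n).
Proof. by move=> i; rewrite mxE. Qed.

(** Chooses the multiplier of a new row in the double description induction. *)
Lemma finite_separation (I : finType) (P N : pred I) (l h : I -> R) :
  (forall i j, P i -> N j -> l i <= h j) ->
  exists a, (forall i, P i -> l i <= a) /\ (forall j, N j -> a <= h j).
Proof.
move=> H; case: (pickP P) => [i0 Pi0|P0].
  exists (l [arg max_(i > i0 | P i) l i]%O).
  by case: arg_maxP => // i Pi hi; split=> // j; exact: H.
case: (pickP N) => [j0 Nj0|N0].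
  exists (h [arg min_(j < j0 | N j) h j]%O).
  by case: arg_minP => // j Nj hj; split=> // i; rewrite P0.
by exists 0; split=> [i|j]; rewrite ?P0 ?N0.
Qed.

(** One step of the double description method: generators of the cone cut by
    the hyperplane orthogonal to [a] are those lying on it and, for each pair on
    opposite sides, the point where their joining segment crosses it. *)
Definition cut_generator n (a : 'cV[R]_n) (I : finType) (g : I -> 'cV[R]_n)
    (k : I + I * I) : 'cV[R]_n :=
  match k with
  | inl i => if dot a (g i) == 0 then g i else 0
  | inr (i, j) =>
      if (0 < dot a (g i)) && (dot a (g j) < 0)
      then (- dot a (g j)) *: g i + dot a (g i) *: g j else 0
  end.

Lemma dot_sumr n (a : 'cV[R]_n) (I : finType) (al : I -> R) (g : I -> 'cV[R]_n) :
  dot a (\sum_i al i *: g i) = \sum_i al i * dot a (g i).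
Proof.
elim/big_ind2 : _ => [|x1 x2 y1 y2 <- <-|i _].
- exact: (form0r (dot_psd n)).
- exact: (formDr (dot_psd n)).
- exact: (formZr (dot_psd n)).
Qed.

(** With [d i] the height of [g i] over the hyperplane, the total height [S]
    above equals the total depth below; transporting the mass [al i * al j / S]
    between each pair on opposite sides rewrites the combination with the
    crossing points.  When [S = 0] only generators on the hyperplane occur. *)
Lemma cut_generatorP n (a : 'cV[R]_n) (I : finType) (g : I -> 'cV[R]_n)
    (al : I -> R) :
  (forall i, 0 <= al i) -> dot a (\sum_i al i *: g i) = 0 ->
  exists be : I + I * I -> R, (forall k, 0 <= be k) /\
    \sum_i al i *: g i = \sum_k be k *: cut_generator a g k.
Proof.
move=> al0; rewrite dot_sumr.
have [d dE] : exists d : I -> R, forall i, dot a (g i) = d i.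
  by exists (fun i => dot a (g i)).
under eq_bigr => i _ do rewrite dE; move=> d0.
pose S := \sum_(i | 0 < d i) al i * d i.
have SE : S = \sum_(j | d j < 0) al j * - d j.
  rewrite (eq_bigr (fun j => - (al j * d j))) => [|j _]; last by rewrite mulrN.
  rewrite sumrN; apply/eqP; rewrite -addr_eq0 -[X in _ == X]d0; apply/eqP.
  rewrite [RHS](bigID (fun i => 0 < d i)) /=; congr (_ + _).
  rewrite [RHS](bigID (fun i => d i == 0)) /= [X in _ = X + _]big1 ?add0r.
    by apply: eq_bigl => i; rewrite -leNgt andbC -lt_neqAle.
  by move=> i /andP[_ /eqP ->]; rewrite mulr0.
have S0 : 0 <= S by apply: sumr_ge0 => i /ltW hi; rewrite mulr_ge0.
pose b i : R := (0 < d i)%R%:R; pose e i : R := (d i < 0)%R%:R.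
have bd i : b i * d i = if 0 < d i then d i else 0.
  by rewrite /b; case: ifP; rewrite ?mul1r ?mul0r.
have ed i : e i * - d i = if d i < 0 then - d i else 0.
  by rewrite /e; case: ifP; rewrite ?mul1r ?mul0r.
have SbE : S = \sum_i al i * (b i * d i).
  by rewrite /S big_mkcond; apply: eq_bigr => i _; rewrite bd; case: ifP; rewrite ?mulr0.
have SeE : S = \sum_i al i * (e i * - d i).
  by rewrite SE big_mkcond; apply: eq_bigr => i _; rewrite ed; case: ifP; rewrite ?mulr0.
pose be (k : I + I * I) := match k with inl i => al i | inr (i, j) => al i * al j / S end.
exists be; split=> [[i|[i j]]|]; rewrite /be ?divr_ge0 ?mulr_ge0 //.
have gE i j : cut_generator a g (inr (i, j)) =
    (b i * (e j * - d j)) *: g i + (e j * (b i * d i)) *: g j.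
  rewrite bd ed /b /e /= !dE.
  by case: (0 < d i); case: (d j < 0);
    rewrite /= ?(mulr0, mul0r, mul1r, scale0r, addr0).
have alb i : al i *: g i = (al i * (d i == 0)%R%:R) *: g i + (al i * b i) *: g i
    + (al i * e i) *: g i.
  rewrite -!scalerDl -!mulrDr /b /e; case: (ltgtP (d i) 0) => _;
  by rewrite ?(addr0, add0r) mulr1.
rewrite (eq_bigr _ (fun i _ => alb i)) !big_split /= big_sumType /= -addrA.
congr (_ + _).
  apply: eq_bigr => i _; rewrite dE.
  by case: ifP; rewrite ?mulr1 ?mulr0 ?scale0r ?scaler0.
transitivity (\sum_i \sum_j ((al i * al j / S * (b i * (e j * - d j))) *: g i
    + (al i * al j / S * (e j * (b i * d i))) *: g j)); last first.
  rewrite pair_big; apply: eq_bigr => -[i j] _.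
  by rewrite -[RHS]/(be (inr (i, j)) *: cut_generator a g (inr (i, j))) gE
    scalerDr !scalerA.
under [RHS]eq_bigr => i _ do rewrite big_split /=.
rewrite big_split /=.
(* The factor [S / S] is harmless: if [S = 0] then all summands of [S] vanish. *)
have key (F G : I -> R) : (forall i, 0 <= F i) -> S = \sum_i F i ->
    (forall i, F i = 0 -> G i = 0) -> forall i, G i * (S / S) = G i.
  move=> F0 SF FG i; have [Sz|Sn] := eqVneq S 0; last by rewrite divff ?mulr1.
  rewrite FG ?mul0r //; apply/eqP; move/eqP: Sz; rewrite SF psumr_eq0 // => /allP.
  by move=> /(_ i (mem_index_enum i)).
congr (_ + _).
  apply: eq_bigr => i _; rewrite -scaler_suml; congr (_ *: _).
  rewrite (eq_bigr (fun j => al i * b i / S * (al j * (e j * - d j)))) => [|j _];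
    last by ring.
  rewrite -mulr_sumr -SeE -mulrA [S^-1 * S]mulrC.
  rewrite (key (fun i => al i * (b i * d i)) (fun i => al i * b i)) // => j.
    by rewrite bd; case: ifP => [/ltW|] hj; rewrite ?mulr0 // mulr_ge0.
  rewrite /b; case: (ltP 0 (d j)) => hj; rewrite ?mulr0 // mul1r mulr1 => /eqP.
  by rewrite mulf_eq0 (gt_eqF hj) orbF => /eqP.
rewrite exchange_big; apply: eq_bigr => j _ /=; rewrite -scaler_suml; congr (_ *: _).
rewrite (eq_bigr (fun i => al j * e j / S * (al i * (b i * d i)))) => [|i _];
  last by ring.
rewrite -mulr_sumr -SbE -mulrA [S^-1 * S]mulrC.
rewrite (key (fun i => al i * (e i * - d i)) (fun i => al i * e i)) // => i.
  rewrite ed; case: ifP => [/ltW|] hi; rewrite ?mulr0 // mulr_ge0 //.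
  by rewrite oppr_ge0.
rewrite /e; case: (ltP (d i) 0) => hi; rewrite ?mulr0 // mul1r mulr1 => /eqP.
by rewrite mulf_eq0 oppr_eq0 (lt_eqF hi) orbF => /eqP.
Qed.

Lemma dot_delta n (y : 'cV[R]_n) i : dot y (delta_mx i 0) = y i 0.
Proof.
rewrite /dot (bigD1 i) //= mxE !eqxx mulr1 big1 ?addr0 // => j /negPf hj.
by rewrite mxE hj mulr0.
Qed.

(** Minkowski-Weyl and Farkas in one induction on the number of equations.
    For the dual half, nonnegativity of [y] on the crossing points says exactly
    that the lower bounds on a multiplier of the new row, one per generator above
    the hyperplane, lie below the upper bounds, one per generator under it. *)
Theorem orthant_kernel_cone p n (B : 'M[R]_(p, n)) :
  exists (I : finType) (g : I -> 'cV[R]_n),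
    [/\ forall i, orthant (g i) /\ B *m g i = 0,
        forall x, orthant x -> B *m x = 0 ->
          exists al : I -> R, (forall i, 0 <= al i) /\ x = \sum_i al i *: g i
      & forall y, (forall i, 0 <= dot y (g i)) ->
          exists v, orthant (y + B^T *m v)].
Proof.
elim: p B => [B|p IH].
  exists 'I_n, (fun i => delta_mx i 0); split=> [i|x hx _|y hy].
  - split; last by rewrite flatmx0.
    by move=> j; rewrite mxE ler0n.
  - exists (fun i => x i 0); split=> //.
    by rewrite [LHS]matrix_sum_delta; apply: eq_bigr => i _; rewrite big_ord1.
  - exists 0 => i; rewrite mulmx0 addr0; by have := hy i; rewrite dot_delta.
rewrite -[p.+1]/(1 + p)%N => B.
have [I [g [gP gx gy]]] := IH (dsubmx B).
pose a := (usubmx B)^T.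
have BE x : B *m x = col_mx (dot a x)%:M (dsubmx B *m x).
  rewrite -[B in LHS]vsubmxK mul_col_mx; congr col_mx.
  by apply/matrixP => i j; rewrite dotE trmxK !ord1 [RHS]mxE eqxx.
exists (I + I * I)%type, (cut_generator a g); split.
- move=> k; rewrite BE; case: k => [i|[i j]] /=.
    have [gi Bi] := gP i; case: ifP => [/eqP -> |_].
      by split; rewrite // Bi raddf0 col_mx0.
    by split; [exact: orthant0|rewrite (form0r (dot_psd n)) mulmx0 raddf0 col_mx0].
  have [[gi Bi] [gj Bj]] := (gP i, gP j); case: ifP => [/andP[hi hj]|_]; last first.
    by split; [exact: orthant0|rewrite (form0r (dot_psd n)) mulmx0 raddf0 col_mx0].
  split.
    by apply: orthantD; apply: orthantZ => //; rewrite ?oppr_ge0 ltW.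
  rewrite mulmxDr -!scalemxAr Bi Bj !scaler0 addr0.
  rewrite (formDr (dot_psd n)) !(formZr (dot_psd n)).
  by rewrite mulNr [X in _ + X]mulrC addNr raddf0 col_mx0.
- move=> x hx; rewrite BE -[0]col_mx0 => /eq_col_mx[hax hBx].
  have [al [al0 xE]] := gx x hx hBx.
  rewrite xE in hax *; apply: cut_generatorP => //.
  by move/matrixP/(_ 0 0): hax; rewrite !mxE eqxx.
- move=> y hy.
  have [l [hP hN]] : exists l, (forall i, 0 < dot a (g i) ->
        - dot y (g i) / dot a (g i) <= l) /\
      (forall j, dot a (g j) < 0 -> l <= dot y (g j) / - dot a (g j)).
    apply: (finite_separation (P := fun i => 0 < dot a (g i))
      (N := fun j => dot a (g j) < 0)) => i j hi hj.
    have := hy (inr (i, j)); rewrite /= hi hj /= (formDr (dot_psd n)).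
    rewrite !(formZr (dot_psd n)) => h.
    by rewrite ler_pdivrMr // mulrAC ler_pdivlMr ?oppr_gt0 //; lra.
  have [v hv] : exists v, orthant (y + l *: a + (dsubmx B)^T *m v).
    apply: gy => i; rewrite (formDl (dot_psd n)) (formZl (dot_psd n)).
    case: (ltgtP (dot a (g i)) 0) => hi.
    - by have := hN i hi; rewrite ler_pdivlMr ?oppr_gt0 //; lra.
    - by have := hP i hi; rewrite ler_pdivrMr //; lra.
    - by have := hy (inl i); rewrite /= hi eqxx mulr0 addr0.
  exists (col_mx l%:M v); rewrite -[B]vsubmxK tr_col_mx mul_row_col -/a.
  by rewrite mul_mx_scalar addrA.
Qed.
End Cones.

(** * Error bounds and duality for linear systems *)
Section Hoffman.
Context {R : realType}.

(** Split [f0 - x] into its positive and negative parts; the pair lies in the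
    cone of nonnegative [(p, m)] with [B p = B m] and is a combination of finitely
    many generators.  Each coefficient can be truncated at a multiple of
    [enorm (x - u)] that depends on the generator alone: a truncated generator
    already lifts to zero or above every coordinate that it increases, while a
    coordinate met by no truncated generator is lifted as far as in [f0].
    Coordinates that start nonnegative never drop below the smaller of their
    values in [x] and [f0]. *)
Theorem hoffman_bound p n (B : 'M[R]_(p, n)) :
  exists C, 0 <= C /\ forall x u f0 : 'cV[R]_n, orthant u -> orthant f0 ->
    B *m f0 = B *m x ->
    exists f, [/\ orthant f, B *m f = B *m x & enorm (x - f) <= C * enorm (x - u)].
Proof.
have [I [g [gP gx _]]] := orthant_kernel_cone (row_mx B (- B)).
pose gu k := usubmx (g k); pose gd k := dsubmx (g k).
have gK k : g k = col_mx (gu k) (gd k) by rewrite vsubmxK.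
have gu0 k i : 0 <= gu k i 0 by rewrite mxE; case: (gP k).
have gd0 k i : 0 <= gd k i 0 by rewrite mxE; case: (gP k).
have Bg k : B *m gu k = B *m gd k.
  have [_] := gP k; rewrite gK mul_row_col mulNmx => /eqP.
  by rewrite subr_eq0 => /eqP.
(* At least the inverse of every positive coordinate of [gu k], as [0^-1 = 0]. *)
pose c k := \sum_i (gu k i 0)^-1.
have c0 k : 0 <= c k by apply: sumr_ge0 => i _; rewrite invr_ge0.
have cg k i : 0 < gu k i 0 -> 1 <= c k * gu k i 0.
  move=> hi; rewrite -(mulVf (lt0r_neq0 hi)) ler_wpM2r //.
  rewrite /c (bigD1 i) //= lerDl.
  by apply: sumr_ge0 => j _; rewrite invr_ge0.
exists (\sum_k c k * enorm (gd k - gu k)); split.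
  by apply: sumr_ge0 => k _; rewrite mulr_ge0 ?enorm_ge0.
move=> x u f0 hu hf0 Bf0; set om := enorm (x - u).
have om0 : 0 <= om by exact: enorm_ge0.
pose up : 'cV[R]_n := \col_i Num.max 0 (f0 i 0 - x i 0).
pose un : 'cV[R]_n := \col_i Num.max 0 (x i 0 - f0 i 0).
have upn : up - un = f0 - x.
  by apply/colP => i; rewrite !mxE; case: (leP 0 (f0 i 0 - x i 0));
    case: (leP 0 (x i 0 - f0 i 0)); lra.
have [|| al [al0 wE]] := gx (col_mx up un).
- by move=> i; rewrite mxE; case: splitP => j _; rewrite mxE le_max lexx.
- rewrite mul_row_col mulNmx -mulmxBr upn mulmxBr Bf0 subrr //.
have upE i : up i 0 = \sum_k al k * gu k i 0.
  have /(congr1 usubmx) := wE; rewrite col_mxKu => ->.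
  rewrite mxE summxE; apply: eq_bigr => k _.
  by rewrite /gu !mxE.
have unE i : un i 0 = \sum_k al k * gd k i 0.
  have /(congr1 dsubmx) := wE; rewrite col_mxKd => ->.
  rewrite mxE summxE; apply: eq_bigr => k _.
  by rewrite /gd !mxE.
pose be k := Num.min (al k) (om * c k).
have be0 k : 0 <= be k by rewrite le_min al0 mulr_ge0.
have bea k : be k <= al k by rewrite ge_min lexx.
exists (x + \sum_k be k *: (gu k - gd k)); split.
- move=> i; rewrite mxE summxE.
  rewrite (eq_bigr (fun k => be k * gu k i 0 - be k * gd k i 0)); last first.
    by move=> k _; rewrite /gu /gd !mxE mulrBr.
  rewrite sumrB.
  have h1 : \sum_k be k * gd k i 0 <= un i 0.
    by rewrite unE; apply: ler_sum => k _; rewrite ler_wpM2r.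
  have h2 : 0 <= \sum_k be k * gu k i 0.
    by apply: sumr_ge0 => k _; rewrite mulr_ge0.
  have := hf0 i; move: h1; rewrite mxE; have [xi|xi] := leP 0 (x i 0).
    by case: (leP 0 (x i 0 - f0 i 0)); lra.
  move=> h1 fi; suff : - x i 0 <= \sum_k be k * gu k i 0.
    by move: h1; case: (leP 0 (x i 0 - f0 i 0)); lra.
  case: (pickP (fun k => (0 < gu k i 0) && (om * c k < al k))) => [k /andP[gk hk]|h].
    rewrite (bigD1 k) //=.
    apply: (@le_trans _ _ (be k * gu k i 0)); last first.
      by rewrite lerDl; apply: sumr_ge0 => l _; rewrite mulr_ge0.
    rewrite /be min_r ?(ltW hk) // -mulrA.
    apply: (@le_trans _ _ om); last by rewrite ler_peMr ?cg.
    have := coord_le_enorm (x - u) i; rewrite -/om !mxE ler_norml.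
    by have := hu i; lra.
  rewrite (eq_bigr (fun k => al k * gu k i 0)) => [|k _].
    by rewrite -upE mxE; case: (leP 0 (f0 i 0 - x i 0)); lra.
  have := h k; have := gu0 k i; rewrite le_eqVlt => /orP[/eqP <-|->] /=.
    by rewrite !mulr0.
  by move=> /negbT; rewrite -leNgt => hk; rewrite /be min_l.
- rewrite mulmxDr mulmx_sumr big1 ?addr0 // => k _.
  by rewrite -scalemxAr mulmxBr Bg subrr scaler0.
- rewrite opprD addrA subrr add0r -sumrN mulr_suml.
  apply: le_trans (enorm_sum _) _; apply: ler_sum => k _.
  rewrite -scalerN opprB enormZ ger0_norm // mulrAC ler_wpM2r ?enorm_ge0 //.
  by rewrite mulrC ge_min lexx orbT.
Qed.

Lemma farkas p n (B : 'M[R]_(p, n)) y :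
  (forall x, orthant x -> B *m x = 0 -> 0 <= dot y x) ->
  exists v, orthant (y + B^T *m v).
Proof.
move=> h; have [I [g [gP _ gy]]] := orthant_kernel_cone B.
by apply: gy => i; have [] := gP i; exact: h.
Qed.

(** Farkas on the homogenization: [dot c x >= dot c xs * t] for all nonnegative
    [(x, t)] with [A x = t b], by rescaling when [t > 0] and because [x] is then a
    recession direction when [t = 0].  The multiplier is the dual solution. *)
Lemma strong_duality m n (A : 'M[R]_(m, n)) b c xs :
  Xstar A b c xs -> exists y, orthant (c - A^T *m y) /\ dot c xs <= dot b y.
Proof.
move=> [[Axs xs0] opt]; pose f := dot c xs.
have [|v hv] := @farkas _ _ (row_mx A (- b)) (col_mx c (- f)%:M).
  move=> z; rewrite -[z]vsubmxK; set x := usubmx z; set t := dsubmx z => hz.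
  have hx : orthant x by move=> i; have := hz (lshift _ i); rewrite col_mxEu.
  have ht : 0 <= t 0 0 by have := hz (rshift _ 0); rewrite col_mxEd.
  rewrite mul_row_col dot_col_mx [t]mx11_scalar mul_mx_scalar => /eqP.
  rewrite scalerN subr_eq0 => /eqP Ax.
  rewrite [X in _ + X](_ : _ = - (f * t 0 0)); last first.
    by rewrite /dot big_ord1 !mxE !eqxx !mulr1n mulNr.
  rewrite subr_ge0; move: ht; rewrite le_eqVlt => /orP[/eqP t0|t0].
    have := opt (xs + x); rewrite (formDr (dot_psd n)) -t0 mulr0 lerDl; apply.
    split; last exact: orthantD.
    by rewrite /Vp /= mulmxDr Axs Ax -t0 scale0r addr0.
  have := opt ((t 0 0)^-1 *: x); rewrite (formZr (dot_psd n)).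
  rewrite ler_pdivlMl // mulrC; apply; split.
    by rewrite /Vp /= -scalemxAr Ax scalerA mulVf ?gt_eqF // scale1r.
  by apply: orthantZ; rewrite // invr_ge0 ltW.
exists (- v); move: hv; rewrite tr_row_mx mul_col_mx add_col_mx => hv; split.
  by move=> i; have := hv (lshift _ i); rewrite col_mxEu mulmxN opprK.
have := hv (rshift _ 0); rewrite col_mxEd (formNr (dot_psd m)).
rewrite (_ : (- b)^T *m v = - (b^T *m v)); last by rewrite linearN mulNmx.
by rewrite !mxE eqxx mulr1n -/f dotE mxE addrC subr_ge0 lerNr.
Qed.

End Hoffman.

(** * Attained minima and closest points *)
Section Compactness.
Context {R : realType}.

(** Closedness is read through transposition because the compactness theorem
    behind [attained_min] is about row vectors. *)
Definition cclosed n (K : set 'cV[R]_n) := closed [set v : 'rV[R]_n | K v^T].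

Lemma sum_mul_continuous (T : topologicalType) (I : finType) (F G : I -> T -> R) b :
  (forall j, continuous (F j)) -> (forall j, continuous (G j)) ->
  continuous (fun v => \sum_j F j v * G j v + b).
Proof.
move=> hF hG v; apply: cvgD; last exact: cvg_cst.
apply: cvg_big => [|j _].
  by move=> [x y]; apply: cvgD; [exact: cvg_fst|exact: cvg_snd].
by apply: cvgM; [exact: hF|exact: hG].
Qed.

Lemma affine_coord_continuous p n (M : 'M[R]_(p, n)) (a : 'cV[R]_p) i :
  continuous (fun v : 'rV[R]_n => (M *m v^T + a) i 0).
Proof.
rewrite (_ : (fun v : 'rV_n => _) = (fun v => \sum_j M i j * v 0 j + a i 0)).
  apply: sum_mul_continuous => j; first exact: cst_continuous.
  exact: coord_continuous.
apply/funext => v; rewrite !mxE; congr (_ + _).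
by apply: eq_bigr => j _; rewrite !mxE.
Qed.

Lemma affine_sqnorm_continuous p n (M : 'M[R]_(p, n)) (a : 'cV[R]_p) :
  continuous (fun v : 'rV[R]_n => dot (M *m v^T + a) (M *m v^T + a)).
Proof.
rewrite (_ : (fun v : 'rV_n => _) = fun v : 'rV_n =>
  \sum_i (M *m v^T + a) i 0 * (M *m v^T + a) i 0 + 0); last first.
  by apply/funext => v; rewrite addr0.
by apply: sum_mul_continuous => j; exact: affine_coord_continuous.
Qed.

Lemma cclosed_affine p n (M : 'M[R]_(p, n)) (d : 'cV[R]_p) :
  cclosed [set x | M *m x = d].
Proof.
rewrite /cclosed (_ : mkset _ = \bigcap_(i in setT)
   ((fun v : 'rV[R]_n => (M *m v^T + 0) i 0) @^-1` [set x | x = d i 0])).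
  apply: closed_bigI => i _; apply: preimage_closed; last exact: closed_eq.
  by move=> x _; exact: affine_coord_continuous.
apply/seteqP; split=> [v /= h i _ /=|v /= h]; first by rewrite addr0 h.
by apply/colP => i; have := h i I; rewrite /= addr0.
Qed.

Lemma cclosed_orthant n : cclosed (orthant : set 'cV[R]_n).
Proof.
rewrite /cclosed (_ : mkset _ = \bigcap_(i in setT)
   ((fun v : 'rV[R]_n => (1%:M *m v^T + 0) i 0) @^-1` [set x | 0 <= x])).
  apply: closed_bigI => i _; apply: preimage_closed; last exact: closed_ge.
  by move=> x _; exact: affine_coord_continuous.
apply/seteqP; split=> [v /= h i _ /=|v /= h]; first by rewrite addr0 mul1mx; exact: h.
by move=> i; have := h i I; rewrite /= addr0 mul1mx.
Qed.

Lemma cclosed_sqnorm p n (M : 'M[R]_(p, n)) (a : 'cV[R]_p) r :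
  cclosed [set x | dot (M *m x + a) (M *m x + a) <= r].
Proof.
apply: (@preimage_closed _ _ (fun v : 'rV[R]_n => dot (M *m v^T + a) (M *m v^T + a))
  [set x | x <= r]); last exact: closed_le.
by move=> x _; exact: affine_sqnorm_continuous.
Qed.

Lemma attained_min n (K : set 'cV[R]_n) (f : 'cV[R]_n -> R) r :
  K !=set0 -> cclosed K -> continuous (fun v : 'rV[R]_n => f v^T) ->
  (forall x, K x -> enorm x <= r) ->
  exists x, K x /\ forall y, K y -> f x <= f y.
Proof.
move=> [x0 Kx0] Kcl fc Kb.
have Kcp : compact [set v : 'rV[R]_n | K v^T].
  apply: bounded_closed_compact Kcl; exists r; split; first exact: num_real.
  move=> M rM v /= Kv; rewrite [leLHS]/Num.Def.normr /= mx_normrE.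
  apply: bigmax_le => [|[i j] _ /=].
    by apply: le_trans (ltW rM); apply: le_trans (Kb _ Kx0); exact: enorm_ge0.
  rewrite ord1; have := coord_le_enorm v^T j; rewrite mxE => h.
  exact: le_trans h (le_trans (Kb _ Kv) (ltW rM)).
have [|v Kv hv] := EVT_min_rV _ Kcp (continuous_subspaceT fc).
  by exists x0^T; rewrite /= trmxK.
exists v^T; split; first by rewrite inE in Kv.
by move=> y Ky; have := hv y^T; rewrite inE /= trmxK; exact.
Qed.

Lemma closest_point p n (B : 'M[R]_(p, n)) d v :
  Fp B d !=set0 ->
  exists u, Fp B d u /\ forall w, Fp B d w -> enorm (v - u) <= enorm (v - w).
Proof.
move=> [x0 Fx0]; pose r := dot (x0 - v) (x0 - v).
pose K := Fp B d `&` [set x | dot (1%:M *m x - v) (1%:M *m x - v) <= r].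
have [|||x Kx|x [Kx hx]] := @attained_min _ K
    (fun x => dot (1%:M *m x - v) (1%:M *m x - v)) (Num.sqrt r + enorm v).
- by exists x0; split; rewrite //= mul1mx.
- apply: closedI; last exact: cclosed_sqnorm.
  by apply: closedI; [exact: cclosed_affine|exact: cclosed_orthant].
- exact: affine_sqnorm_continuous.
- case: Kx => _ /=; rewrite mul1mx -enormE => hx.
  rewrite -[x](subrK v); apply: le_trans (enormD _ _) _; rewrite lerD2r.
  rewrite -(@ler_pXn2r _ 2) ?nnegrE ?enorm_ge0 ?sqrtr_ge0 //.
  by rewrite [leRHS]sqr_sqrtr //; exact: (form_ge0 (dot_psd n)).
- exists x; split; first by case: Kx.
  move=> w Fw; rewrite enormB [leRHS]enormB enorm_le_sqr.
  have [hw|hw] := leP (dot (w - v) (w - v)) r.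
    by have := hx w; rewrite !mul1mx; apply; split; rewrite //= mul1mx.
  by case: Kx => _ /=; rewrite mul1mx => /le_trans; apply; exact: ltW.
Qed.

Lemma Dist_attained p n (B : 'M[R]_(p, n)) d v :
  Fp B d !=set0 -> exists2 u, Fp B d u & Dist v (Fp B d) = enorm (v - u).
Proof.
move=> /(closest_point v)[u [Fu hu]]; exists u => //; exact: Dist_eq.
Qed.

End Compactness.

(** * Singular values and the pseudo-inverse *)
Section SingularValues.
Context {R : realType}.

(** The extremal value of the Rayleigh quotient on the kernel of [B]: its minimum
    for [s = 1], its maximum for [s = -1].  The first variation at the extremum
    vanishes in every direction of the kernel, and the kernel contains the
    gradient, so the extremal vector is an eigenvector of [A^T A]. *)
Lemma rayleigh p m n (A : 'M[R]_(m, n)) (B : 'M[R]_(p, n)) (s : R) :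
  s != 0 -> (forall u : 'cV[R]_m, B *m (A^T *m u) = 0) ->
  (exists v : 'cV[R]_n, B *m v = 0 /\ v != 0) ->
  exists v0, [/\ B *m v0 = 0, dot v0 v0 = 1,
    A^T *m (A *m v0) = dot (A *m v0) (A *m v0) *: v0
    & forall v, B *m v = 0 ->
        s * (dot (A *m v0) (A *m v0) * dot v v) <= s * dot (A *m v) (A *m v)].
Proof.
move=> s0 BA [w [Bw w0]].
pose K : set 'cV[R]_n := [set x | B *m x = 0] `&` [set x | dot (1%:M *m x + 0) (1%:M *m x + 0) <= 1]
  `&` [set x | 1 <= dot (1%:M *m x + 0) (1%:M *m x + 0)].
have KP x : K x <-> B *m x = 0 /\ dot x x = 1.
  rewrite /K /= mul1mx addr0; split; first by move=> [[-> h1] h2]; split=> //; lra.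
  by move=> [-> ->].
pose f x := s * dot (A *m x + 0) (A *m x + 0).
have scale v : B *m v = 0 -> v != 0 -> K ((enorm v)^-1 *: v).
  move=> Bv v0; apply/KP; rewrite -scalemxAr Bv scaler0; split=> //.
  rewrite (formZl (dot_psd n)) (formZr (dot_psd n)) -enormE mulrA -expr2.
  by rewrite -exprMn mulVf ?expr1n // gt_eqF // enorm_gt0.
have [||||v0 [/KP[Bv0 v01] hv0]] := @attained_min _ _ K f 1.
- by exists ((enorm w)^-1 *: w); exact: scale.
- apply: closedI; first by apply: closedI; [exact: cclosed_affine|exact: cclosed_sqnorm].
  apply: (@preimage_closed _ _
    (fun v : 'rV[R]_n => dot (1%:M *m v^T + 0) (1%:M *m v^T + 0)) [set x | 1 <= x]).
    by move=> x _; exact: affine_sqnorm_continuous.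
  exact: closed_ge.
- rewrite (_ : (fun v : 'rV_n => _) = fun v : 'rV_n =>
    \sum_i (s * (A *m v^T + 0) i 0) * (A *m v^T + 0) i 0 + 0); last first.
    apply/funext => v; rewrite /f /dot [RHS]addr0 mulr_sumr.
    by apply: eq_bigr => i _; rewrite mulrA.
  apply: sum_mul_continuous => j; last exact: affine_coord_continuous.
  rewrite (_ : (fun v : 'rV_n => _) = fun v : 'rV_n =>
    ((s *: A) *m v^T + 0) j 0); first exact: affine_coord_continuous.
  by apply/funext => v; rewrite -scalemxAl !addr0 [RHS]mxE.
- by move=> x /KP[_ x1]; rewrite /enorm x1 sqrtr1.
set l := dot (A *m v0) (A *m v0).
have ineq v : B *m v = 0 -> s * (l * dot v v) <= s * dot (A *m v) (A *m v).
  have [->|vn0 Bv] := eqVneq v 0.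
    by rewrite !mulmx0 (form0l (dot_psd n)) (form0l (dot_psd m)) !mulr0.
  have := hv0 _ (scale v Bv vn0); rewrite /f !addr0 -/l -scalemxAr.
  rewrite (formZl (dot_psd m)) (formZr (dot_psd m)) mulrA -expr2 exprVn enormE.
  rewrite mulrCA ler_pdivlMl ?enorm_gt0_dot //.
  by rewrite mulrCA [dot v v * _]mulrC.
exists v0; split=> //; apply/eqP; rewrite -subr_eq0; apply/eqP.
set h := A^T *m (A *m v0) - l *: v0.
have Bh : B *m h = 0 by rewrite mulmxBr BA -scalemxAr Bv0 scaler0 subrr.
apply: dot_eq0.
have hE : dot h h = dot (A *m v0) (A *m h) - l * dot v0 h.
  by rewrite {1}/h (formBl (dot_psd n)) (formZl (dot_psd n)) dot_mulmx trmxK.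
rewrite hE.
pose b := s * (dot (A *m v0) (A *m h) - l * dot v0 h).
pose e := s * (dot (A *m h) (A *m h) - l * dot h h).
have he : 0 <= e by have := ineq h Bh; rewrite /e; lra.
have quad t : 0 <= 2 * t * b + t ^+ 2 * e.
  have := ineq (v0 + t *: h); rewrite !mulmxDr -!scalemxAr Bv0 Bh scaler0 addr0.
  move=> /(_ erefl); rewrite !form_sqrD; try exact: dot_psd.
  by rewrite v01 -/l /b /e; lra.
have : b = 0.
  have e1 : e + 1 != 0 by rewrite gt_eqF // ltr_wpDl.
  have := quad (- b / (e + 1)).
  rewrite (_ : _ + _ = - (b ^+ 2) * ((e + 2) / (e + 1) ^+ 2)); last by field.
  rewrite mulNr oppr_ge0 pmulr_lle0; last first.
    by rewrite divr_gt0 ?ltr_wpDl // exprn_gt0 // ltr_wpDl.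
  by rewrite le_eqVlt ltNge sqr_ge0 orbF sqrf_eq0 => /eqP.
by move=> /eqP; rewrite mulf_eq0 (negPf s0) => /eqP.
Qed.

Lemma trmx_mul_eq0 m n (A : 'M[R]_(m, n)) (v : 'cV[R]_n) : A^T *m (A *m v) = 0 -> A *m v = 0.
Proof.
move=> h; apply: dot_eq0; rewrite dot_mulmx h; exact: (form0r (dot_psd n)).
Qed.

Lemma singular_valueP m n (A : 'M[R]_(m, n)) l :
  nonzero_singular_values A l <->
  0 < l /\ exists v : 'cV[R]_n, A^T *m (A *m v) = l ^+ 2 *: v /\ v != 0.
Proof.
split=> -[l0 h]; split=> //.
  have /eigenvalueP[v hv v0] := h; exists v^T; split; last by rewrite trmx_eq0.
  by rewrite mulmxA -linearZ -hv /= !trmx_mul trmxK.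
have [v [hv v0]] := h; apply/eigenvalueP; exists v^T; last by rewrite trmx_eq0.
by rewrite -linearZ -hv /= !trmx_mul trmxK mulmxA.
Qed.

(** The largest singular value is the maximum of the Rayleigh quotient on the
    whole space.  The smallest nonzero one is its minimum on the range of [A^T],
    which contains every eigenvector for a nonzero eigenvalue. *)
Theorem singular_value_bounds m n (A : 'M[R]_(m, n)) : A != 0 ->
  [/\ 0 < lambda_min A, lambda_min A <= lambda_max A,
      forall x, enorm (A *m x) <= lambda_max A * enorm x
    & forall y, lambda_min A * enorm (A^T *m y) <= enorm (A *m (A^T *m y))].
Proof.
move=> A0.
have [y0 y00] : exists y : 'cV[R]_m, A^T *m y != 0.
  apply: contrapT => h; move: A0; apply/negP; rewrite negbK -trmx_eq0; apply/eqP.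
  apply/matrixP => i j; have /matrixP/(_ i 0) : A^T *m delta_mx j (0 : 'I_1) = 0.
    by apply: contrapT => hj; apply: h; exists (delta_mx j 0); apply/eqP.
  by rewrite -colE !mxE.
pose v1 := A^T *m y0; pose B : 'M[R]_n := (cokermx A)^T.
have BA (u : 'cV[R]_m) : B *m (A^T *m u) = 0.
  by rewrite mulmxA -trmx_mul mulmx_coker trmx0 mul0mx.
have AB v : B *m v = 0 -> exists u : 'cV[R]_m, v = A^T *m u.
  move=> /(congr1 trmx); rewrite trmx_mul trmxK trmx0 => /eqP.
  by rewrite -submxE => /submxP[D hD]; exists D^T; rewrite -trmx_mul -hD trmxK.
have Av0 v : B *m v = 0 -> v != 0 -> 0 < dot (A *m v) (A *m v).
  move=> /AB[u ->] u0; apply: enorm_gt0_dot; apply: contra u0 => /eqP h.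
  apply/eqP; apply: trmx_mul_eq0; rewrite trmxK h //.
have [|w [Bw w1 wE wmin]] := @rayleigh _ _ _ A B 1 (oner_neq0 _) BA.
  by exists v1; rewrite BA.
have [|||z [_ z1 zE zmax]] := @rayleigh 0 _ _ A 0 (- 1).
- by rewrite oppr_eq0 oner_neq0.
- by move=> u; rewrite mul0mx.
- by exists v1; rewrite mul0mx.
have w0 : w != 0 by apply/negP => /eqP h; move: w1; rewrite h (form0l (dot_psd n)); lra.
have z0 : z != 0 by apply/negP => /eqP h; move: z1; rewrite h (form0l (dot_psd n)); lra.
have sv v : A^T *m (A *m v) = dot (A *m v) (A *m v) *: v -> v != 0 ->
    0 < dot (A *m v) (A *m v) -> nonzero_singular_values A (enorm (A *m v)).
  move=> vE v0 vp; apply/singular_valueP; split.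
    by rewrite -(@ltr_pXn2r _ 2) ?nnegrE ?enorm_ge0 // expr0n enormE.
  by exists v; rewrite enormE.
have zmax' v : dot (A *m v) (A *m v) <= dot (A *m z) (A *m z) * dot v v.
  by have := zmax v (mul0mx _ _); lra.
have wmin' v : B *m v = 0 -> dot (A *m w) (A *m w) * dot v v <= dot (A *m v) (A *m v).
  by move=> /wmin; lra.
have zp : 0 < dot (A *m z) (A *m z).
  have := zmax' v1; have := Av0 v1 (BA _) y00.
  by have := enorm_gt0_dot y00; rewrite -/v1; nra.
have svz := sv z zE z0 zp.
have svw := sv w wE w0 (Av0 w Bw w0).
have ubz l : nonzero_singular_values A l -> l <= enorm (A *m z).
  move=> /singular_valueP[l0 [v [vE v0]]].
  rewrite -(@ler_pXn2r _ 2) ?nnegrE ?enorm_ge0 ?(ltW l0) // enormE.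
  have := zmax' v; rewrite dot_mulmx vE (formZr (dot_psd n)).
  by rewrite ler_pM2r // enorm_gt0_dot.
have lbw l : nonzero_singular_values A l -> enorm (A *m w) <= l.
  move=> /singular_valueP[l0 [v [vE v0]]].
  have Bv : B *m v = 0.
    have l20 : l ^+ 2 != 0 by rewrite expf_neq0 // gt_eqF.
    by rewrite -[v](scalerK l20) -vE -scalemxAr BA scaler0.
  rewrite -(@ler_pXn2r _ 2) ?nnegrE ?enorm_ge0 ?(ltW l0) // enormE.
  have := wmin' v Bv; rewrite [dot (A *m v) _]dot_mulmx vE (formZr (dot_psd n)).
  by rewrite ler_pM2r // enorm_gt0_dot.
have lmaxE : lambda_max A = enorm (A *m z).
  apply/le_anti/andP; split; first by apply: ge_sup => //; exists (enorm (A *m z)).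
  by apply: ub_le_sup => //; exists (enorm (A *m z)).
have lminE : lambda_min A = enorm (A *m w).
  apply/le_anti/andP; split; last by apply: lb_le_inf => //; exists (enorm (A *m w)).
  by apply: ge_inf => //; exists (enorm (A *m w)).
split.
- by rewrite lminE -(@ltr_pXn2r _ 2) ?nnegrE ?enorm_ge0 // expr0n enormE Av0.
- by rewrite lminE lmaxE ubz.
- move=> x; rewrite -(@ler_pXn2r _ 2) ?nnegrE ?mulr_ge0 ?lmaxE ?enorm_ge0 //.
  by rewrite exprMn !enormE.
- move=> y; rewrite -(@ler_pXn2r _ 2) ?nnegrE ?mulr_ge0 ?lminE ?enorm_ge0 //.
  by rewrite exprMn !enormE wmin'.
Qed.

Lemma gram_unit r n (D : 'M[R]_(r, n)) : row_free D -> D *m D^T \in unitmx.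
Proof.
move=> hD; rewrite -row_free_unit; apply: inj_row_free => v h.
have hv : D^T *m v^T = 0.
  by apply: trmx_mul_eq0; rewrite -!trmx_mul -mulmxA h trmx0.
by apply/eqP; rewrite -(mulmx_free_eq0 _ hD) -trmx_eq0 trmx_mul hv.
Qed.

(** From a full-rank factorization [G = C D], whose two Gram matrices are
    invertible. *)
Lemma pinv_exists m n (G : 'M[R]_(m, n)) : exists P, is_pinv G P.
Proof.
have [r [C [D [GE hC hD]]]] : exists r (C : 'M[R]_(m, r)) (D : 'M[R]_(r, n)),
    [/\ G = C *m D, row_free C^T & row_free D].
  exists (\rank G), (col_base G), (row_base G); rewrite mulmx_base row_base_free.
  by split; rewrite // /row_free mxrank_tr; exact: col_base_full.
pose DD := invmx (D *m D^T); pose CC := invmx (C^T *m C).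
have uD : D *m D^T \in unitmx by exact: gram_unit.
have uC : C^T *m C \in unitmx by rewrite -{2}[C]trmxK gram_unit.
have CCK : CC *m (C^T *m C) = 1%:M by exact: mulVmx.
have DDK : D *m D^T *m DD = 1%:M by exact: mulmxV.
have GP : C *m D *m (D^T *m DD *m CC *m C^T) = C *m CC *m C^T.
  by rewrite !mulmxA -(mulmxA C) -(mulmxA C) DDK mulmx1.
have PG : D^T *m DD *m CC *m C^T *m (C *m D) = D^T *m DD *m D.
  by rewrite mulmxA -(mulmxA _ C^T C) -(mulmxA _ CC) CCK mulmx1.
have DDT : DD^T = DD by rewrite trmx_inv trmx_mul trmxK.
have CCT : CC^T = CC by rewrite trmx_inv trmx_mul trmxK.
exists (D^T *m DD *m CC *m C^T); rewrite GE; split.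
- by rewrite GP mulmxA -(mulmxA _ C^T C) -(mulmxA _ CC) CCK mulmx1.
- by rewrite PG !mulmxA -(mulmxA _ D D^T) -(mulmxA _ (D *m D^T)) DDK mulmx1.
- by rewrite GP !trmx_mul trmxK CCT mulmxA.
- by rewrite PG !trmx_mul trmxK DDT mulmxA.
Qed.

Lemma pinvP m n (G : 'M[R]_(m, n)) : is_pinv G (pinv G).
Proof. by have [P hP] := pinv_exists G; apply: xgetPex; exists P. Qed.

(** Cancelling the transposed factor: [E := G P A - A] satisfies [E A^T = 0] and
    has its rows in the row space of [A], hence [E E^T = 0]. *)
Lemma gram_pinv m n (A : 'M[R]_(m, n)) :
  A *m A^T *m pinv (A *m A^T) *m A = A /\ A^T *m (A *m A^T *m pinv (A *m A^T)) = A^T.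
Proof.
have [h1 _ h3 _] := pinvP (A *m A^T).
set P := pinv _ in h1 h3 *.
have GPA : A *m A^T *m P *m A = A.
  apply/eqP; rewrite -subr_eq0; set E := _ - A.
  have EE : E = (A *m A^T *m P - 1%:M) *m A by rewrite mulmxBl mul1mx.
  have EA : E *m A^T = 0.
    by rewrite EE -mulmxA mulmxBl mul1mx h1 subrr.
  have EET : E *m E^T = 0 by rewrite {2}EE trmx_mul mulmxA EA mul0mx.
  rewrite -trmx_eq0; apply/eqP/matrixP => i j.
  have : E^T *m delta_mx j (0 : 'I_1) = 0.
    by apply: trmx_mul_eq0; rewrite trmxK mulmxA EET mul0mx.
  by move=> /matrixP/(_ i 0); rewrite -colE [LHS]mxE => ->; rewrite !mxE.
split=> //; rewrite -h3 -trmx_mul GPA //.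
Qed.
End SingularValues.

(** * Sharpness and limiting error ratio of a linear program *)
Section LPGeometry.
Context {R : realType} {p n : nat} (B : 'M[R]_(p, n)) (d : 'cV[R]_p) (c : 'cV[R]_n).
Context (xs : 'cV[R]_n) (hxs : Xstar B d c xs).

(** The optimal face is a polyhedron of the same kind as the feasible set, so
    that closest points and Hoffman bounds apply to it. *)
Lemma XstarE : Xstar B d c = Fp (col_mx B c^T) (col_mx d (dot c xs)%:M).
Proof.
have cE x : c^T *m x = (dot c x)%:M.
  by apply/matrixP => i j; rewrite !ord1 dotE !mxE eqxx.
apply/seteqP; split=> x.
  move=> [[Bx x0] h]; split=> //; rewrite /Vp /= mul_col_mx Bx cE.
  congr (col_mx _ _%:M); apply/le_anti; case: hxs => Fxs hs.
  by rewrite h //= hs.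
move=> [/=]; rewrite /Vp /= mul_col_mx cE => /eq_col_mx[Bx cx] x0.
have {}cx : dot c x = dot c xs.
  by move/matrixP/(_ 0 0): cx; rewrite !mxE eqxx.
by split=> // x' Fx'; rewrite cx; case: hxs => _; exact.
Qed.

Lemma Xstar_dot x : Xstar B d c x -> dot c x = dot c xs.
Proof. by move=> [Fx h]; case: hxs => Fxs hs; apply/le_anti; rewrite h //= hs. Qed.

Lemma Xstar_closest v :
  exists2 u, Xstar B d c u & Dist v (Xstar B d c) = enorm (v - u).
Proof. by rewrite XstarE; apply: Dist_attained; exists xs; rewrite -XstarE. Qed.

Lemma Xstar_neq0 : Xstar B d c !=set0. Proof. by exists xs. Qed.

Lemma Fp_neq0 : Fp B d !=set0. Proof. by exists xs; case: hxs. Qed.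

Lemma orthant_neq0 : (orthant : set 'cV[R]_n) !=set0.
Proof. by exists 0; exact: orthant0. Qed.

Context (Bc : B *m c = 0).
Context (hnopt : exists x, Fp B d x /\ ~ Xstar B d c x).

Lemma nonoptimal_gt x : Fp B d x -> ~ Xstar B d c x -> dot c xs < dot c x.
Proof.
move=> Fx nx; rewrite ltNge; apply/negP => h; apply: nx; split=> // x' Fx'.
by apply: le_trans h _; case: hxs => _; exact.
Qed.

Lemma objective_neq0 : c != 0.
Proof.
have [x [Fx nx]] := hnopt; apply/negP => /eqP c0.
by have := nonoptimal_gt Fx nx; rewrite c0 !(form0l (dot_psd n)) ltxx.
Qed.

Let c_gt0 : 0 < enorm c := enorm_gt0 objective_neq0.

(** As [c] is parallel to the affine space, moving along [c] reaches the level
    set, so its distance is the objective error divided by [enorm c]. *)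
Lemma Dist_level_le x : Vp B d x ->
  Dist x (Vp B d `&` Hp B d c) <= `|dot c x - dot c xs| / enorm c.
Proof.
move=> Vx; pose a := (dot c x - dot c xs) / dot c c.
have cc : dot c c != 0 by rewrite gt_eqF // enorm_gt0_dot // objective_neq0.
apply: le_trans (Dist_le (u := x - a *: c) _ _) _.
  split; first by rewrite /Vp /= mulmxBr -scalemxAr Bc scaler0 subr0.
  exists xs => //; rewrite (formBr (dot_psd n)) (formZr (dot_psd n)) /a divfK //.
  by rewrite opprB addrCA subrr addr0.
rewrite opprB addrC subrK enormZ /a normrM normfV -enormE.
rewrite [`|enorm c ^+ 2|]ger0_norm ?sqr_ge0 // expr2 invfM mulrA divfK //.
by rewrite gt_eqF.
Qed.

Lemma Dist_nonoptimal_gt0 x : Fp B d x -> ~ Xstar B d c x -> 0 < Dist x (Xstar B d c).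
Proof.
move=> Fx nx; have [u Xu ->] := Xstar_closest x.
apply: enorm_gt0; apply/negP; rewrite subr_eq0 => /eqP xu.
by apply: nx; rewrite xu.
Qed.

Lemma mu_p_le1 : mu_p B d c <= 1.
Proof.
have [x [Fx nx]] := hnopt.
apply: (@le_trans _ _ (Dist x (Vp B d `&` Hp B d c) / Dist x (Xstar B d c))).
  apply: ge_inf; last by exists x.
  by exists 0 => _ [w _ <-]; rewrite divr_ge0 ?Dist_ge0.
rewrite ler_pdivrMr ?Dist_nonoptimal_gt0 // mul1r.
have [u Xu ->] := Xstar_closest x; apply: Dist_le.
by split; [case: Xu => -[]|exists u].
Qed.

(** Hoffman bound for the optimal face: a point of the optimal level set at
    distance [h] from the feasible [x] violates nonnegativity by at most [h]. *)
Lemma mu_p_gt0 : 0 < mu_p B d c.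
Proof.
have [C [C0 hC]] := hoffman_bound (col_mx B c^T).
have C1 : 0 < 1 + C by rewrite ltr_wpDr.
apply: (@lt_le_trans _ _ (1 + C)^-1); first by rewrite invr_gt0.
have [x0 [Fx0 nx0]] := hnopt.
apply: lb_le_inf; first by eexists; exists x0.
move=> _ [x [Fx nx] <-]; rewrite ler_pdivlMr ?Dist_nonoptimal_gt0 //.
rewrite ler_pdivrMl //.
have : Dist x (Xstar B d c) / (1 + C) <= Dist x (Vp B d `&` Hp B d c).
  apply: Dist_ge.
    by exists xs; split; [case: hxs => -[]|exists xs].
  move=> v [Vv [xs' Xxs' cv]]; rewrite ler_pdivrMr //.
  have [|||f [f0 Bf hf]] := hC v x xs; try by case: Fx.
  - by case: hxs => -[].
  - rewrite !mul_col_mx Vv; case: hxs => -[-> _] _; congr col_mx.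
    apply/matrixP => i j; rewrite !ord1 -!dotE cv.
    by rewrite -(Xstar_dot Xxs').
  have Xf : Xstar B d c f.
    rewrite XstarE; split=> //; rewrite /Vp /= Bf mul_col_mx Vv; congr col_mx.
    by apply/matrixP => i j; rewrite !ord1 -!dotE cv (Xstar_dot Xxs') mxE eqxx.
  apply: le_trans (Dist_le x Xf) _.
  apply: le_trans (enorm_triangle _ v _) _.
  by move: hf; rewrite [enorm (v - x)]enormB; lra.
by rewrite ler_pdivrMr // mulrC.
Qed.

Lemma sharpness x : Fp B d x ->
  mu_p B d c * Dist x (Xstar B d c) <= (dot c x - dot c xs) / enorm c.
Proof.
move=> Fx; have [Xx|nx] := pselect (Xstar B d c x).
  rewrite (Xstar_dot Xx) subrr mul0r; have := Dist_le x Xx.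
  rewrite subrr [enorm 0](snorm0 (dot_psd n)) => h.
  by rewrite pmulr_rle0 // mu_p_gt0.
have h : mu_p B d c <= Dist x (Vp B d `&` Hp B d c) / Dist x (Xstar B d c).
  apply: ge_inf; last by exists x.
  by exists 0 => _ [w _ <-]; rewrite divr_ge0 ?Dist_ge0.
have := h; rewrite ler_pdivlMr ?Dist_nonoptimal_gt0 // => /le_trans; apply.
have Vx : Vp B d x by case: Fx.
apply: le_trans (Dist_level_le Vx) _.
by rewrite ger0_norm // subr_ge0 ltW // nonoptimal_gt.
Qed.

Lemma error_ratio_bound : exists C, 1 <= C /\
  forall x, Vp B d x -> Dist x (Fp B d) <= C * Dist x orthant /\
     error_ratio (Vp B d) x <= C.
Proof.
have [C [C0 hC]] := hoffman_bound B; exists (1 + C); split; first by rewrite lerDl.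
move=> x Vx.
have h : Dist x (Fp B d) <= (1 + C) * Dist x orthant.
  rewrite -ler_pdivrMl ?ltr_wpDr //; apply: Dist_ge; first exact: orthant_neq0.
  move=> u u0; rewrite ler_pdivrMl ?ltr_wpDr //.
  have [||f [f0 Bf hf]] := hC x u xs u0.
  - by case: hxs => -[].
  - by case: hxs => -[-> _] _.
  apply: le_trans (Dist_le (u := f) x _) _; first by split; rewrite // /Vp /= Bf.
  by have := enorm_ge0 (x - u); lra.
split=> //; rewrite /error_ratio; case: ifP => _; first by rewrite lerDl.
have := Dist_ge0 x (orthant : set 'cV[R]_n); rewrite le_eqVlt => /orP[/eqP <-|h0].
  by rewrite invr0 mulr0 addr_ge0.
by rewrite ler_pdivrMr.
Qed.

Lemma error_ratioP x : Vp B d x ->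
  Dist x (Fp B d) <= error_ratio (Vp B d) x * Dist x orthant.
Proof.
move=> Vx; rewrite /error_ratio; case: asboolP => [Fx|nF].
  have := Dist_le x Fx; rewrite subrr [enorm 0](snorm0 (dot_psd n)) => h.
  by rewrite mul1r; apply: le_trans h (Dist_ge0 _ _).
have := Dist_ge0 x (orthant : set 'cV[R]_n); rewrite le_eqVlt => /orP[/eqP h|h0].
  have [C [_ /(_ x Vx)[hC _]]] := error_ratio_bound.
  by move: hC; rewrite -h !mulr0.
by rewrite divfK // gt_eqF.
Qed.

(** The suprema over shrinking neighbourhoods decrease and are bounded thanks to
    Hoffman, so the limiting error ratio is their infimum. *)
Lemma theta_p_near eta : 0 < eta -> exists e, 0 < e /\
  forall x, Vp B d x -> Dist x (Xstar B d c) <= e ->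
    error_ratio (Vp B d) x <= theta_p B d c + eta.
Proof.
move=> eta0; have [C [C1 hC]] := error_ratio_bound.
pose S e := [set error_ratio (Vp B d) x | x in Vp B d `&` [set x | Dist x (Xstar B d c) <= e]].
pose h e := sup (S e).
have ubS e : ubound (S e) C by move=> _ [x [Vx _] <-]; have [] := hC x Vx.
have S1 e : 0 <= e -> S e 1.
  move=> e0; have Vxs : Vp B d xs by case: hxs => -[].
  exists xs; last by rewrite /error_ratio asboolT //; case: hxs.
  split=> //=; apply: le_trans (Dist_le xs hxs) _.
  by rewrite subrr [enorm 0](snorm0 (dot_psd n)).
have hE e x : Vp B d x -> Dist x (Xstar B d c) <= e -> error_ratio (Vp B d) x <= h e.
  by move=> Vx xe; apply: ub_le_sup; [exists C; exact: ubS|exists x].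
have hcvg : h x @[x --> 0^'+] --> inf (h @` [set` Interval (BRight 0) (BRight (1 : R))]).
  apply: nondecreasing_at_right_cvgr; first by rewrite bnd_simp.
    move=> x y; rewrite !in_itv /= => /andP[x0 _] _ xy.
    apply: le_sup; [|by exists 1; apply: S1; exact: ltW|].
      move=> _ [u [Vu ux] <-]; exists (error_ratio (Vp B d) u); split=> //.
      by exists u => //; split=> //=; exact: le_trans ux xy.
    by split; [exists 1; apply: S1; apply: le_trans xy; exact: ltW|exists C; exact: ubS].
  exists 1 => y [x /=]; rewrite in_itv /= => /andP[x0 _] <-.
  by apply: ub_le_sup; [exists C; exact: ubS|apply: S1; exact: ltW].
have thE : theta_p B d c = inf (h @` [set` Interval (BRight 0) (BRight (1 : R))]).
  exact/cvg_lim.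
have [_ [e /= he <-] hlt] : exists2 y, (h @` [set` Interval (BRight 0) (BRight (1 : R))]) y
    & y < theta_p B d c + eta.
  rewrite thE; apply: inf_adherent => //; split.
    by exists (h 1), 1 => //=; rewrite in_itv /= ltr01 lexx.
  exists 1 => y [x /=]; rewrite in_itv /= => /andP[x0 _] <-.
  by apply: ub_le_sup; [exists C; exact: ubS|apply: S1; exact: ltW].
move: he; rewrite in_itv /= => /andP[e0 _].
by exists e; split=> // x Vx /(hE e x Vx)/le_trans; apply; exact: ltW.
Qed.

Lemma theta_p_ge1 : 1 <= theta_p B d c.
Proof.
apply/ler_addgt0Pr => eta /theta_p_near[e [e0 h]].
have Vxs : Vp B d xs by case: hxs => -[].
have := h xs Vxs; rewrite {1}/error_ratio asboolT; last by case: hxs.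
apply; apply: le_trans (Dist_le xs hxs) _.
by rewrite subrr [enorm 0](snorm0 (dot_psd n)) ltW.
Qed.

(** A global bound from local data: slide [x] towards its closest optimum [u].
    Along the segment the distance to the optimal set and the objective error
    scale linearly and the infeasibility at most linearly, while close to [u] the
    error ratio is at most [theta + eta].  Near [u], projecting on the feasible set
    and applying sharpness there gives the bound. *)
Theorem LP_error_bound x : Vp B d x ->
  Dist x (Xstar B d c) <= theta_p B d c * (1 + (mu_p B d c)^-1) * Dist x orthant
    + (dot c x - dot c xs) / (mu_p B d c * enorm c).
Proof.
move=> Vx; have mu0 := mu_p_gt0; set mu := mu_p B d c in mu0 *.
set th := theta_p B d c; set de := Dist x orthant.
have de0 : 0 <= de by exact: Dist_ge0.
have K0 : 0 < 1 + mu^-1 by rewrite addr_gt0 // invr_gt0.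
apply/ler_addgt0Pr => e e0.
(* Small enough that its contribution is at most [e]. *)
pose eta := e / ((1 + mu^-1) * de + 1).
have q0 : 0 < (1 + mu^-1) * de + 1 by rewrite ltr_wpDl // mulr_ge0 // ltW.
have eta0 : 0 < eta by rewrite divr_gt0.
have [ep [ep0 hep]] := theta_p_near eta0.
have [u Xu DE] := Xstar_closest x; set D := Dist x _ in DE *.
have D0 : 0 <= D by exact: Dist_ge0.
have [Vu u0] : Fp B d u by case: Xu.
(* Keeps the point [xt] below within [ep] of the optimal set. *)
pose t := Num.min 1 (ep / (D + 1)).
have t0 : 0 < t by rewrite lt_min ltr01 /= divr_gt0 // ltr_wpDl.
have t1 : t <= 1 by rewrite ge_min lexx.
have tD : t * D <= ep.
  have : t <= ep / (D + 1) by rewrite ge_min lexx orbT.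
  rewrite ler_pdivlMr ?ltr_wpDl // => h; apply: le_trans h.
  by rewrite ler_wpM2l ?(ltW t0) // lerDl.
pose xt := u + t *: (x - u).
have Vxt : Vp B d xt.
  by rewrite /Vp /= mulmxDr -scalemxAr mulmxBr Vu Vx subrr scaler0 addr0.
have xtu : enorm (xt - u) = t * D.
  by rewrite /xt addrC addrA addNr add0r enormZ gtr0_norm // DE.
have Dxt : t * D <= Dist xt (Xstar B d c).
  apply: Dist_ge; first exact: Xstar_neq0.
  move=> w Xw; have := Dist_le x Xw; rewrite -/D.
  have := enorm_triangle x xt w.
  have -> : x - xt = (1 - t) *: (x - u).
    by rewrite scalerBl scale1r /xt opprD addrA.
  by rewrite enormZ ger0_norm ?subr_ge0 // -DE; lra.
have xtO : Dist xt orthant <= t * de.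
  rewrite mulrC -ler_pdivrMr //; apply: Dist_ge; first exact: orthant_neq0.
  move=> w w0; rewrite ler_pdivrMr //.
  apply: le_trans (Dist_le (u := (1 - t) *: u + t *: w) xt _) _.
    by apply: orthantD; apply: orthantZ; rewrite ?subr_ge0 // ltW.
  have -> : xt - ((1 - t) *: u + t *: w) = t *: (x - w).
    by apply/colP => i; rewrite !mxE; ring.
  by rewrite enormZ gtr0_norm // mulrC.
have rt : error_ratio (Vp B d) xt <= th + eta.
  apply: hep => //; apply: le_trans (Dist_le xt Xu) _.
  by rewrite xtu.
have xtF : Dist xt (Fp B d) <= (th + eta) * (t * de).
  apply: le_trans (error_ratioP Vxt) _.
  have th0 : 0 <= th + eta.
    by have := theta_p_ge1; rewrite -/th; move: eta0; lra.
  apply: le_trans (ler_wpM2r (Dist_ge0 _ _) rt) _.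
  by rewrite ler_wpM2l.
have [xF FxF DF] := Dist_attained xt Fp_neq0.
have sh := sharpness FxF; rewrite -/mu in sh.
have tri : Dist xt (Xstar B d c) <= enorm (xt - xF) + Dist xF (Xstar B d c).
  by apply: Dist_triangle; exact: Xstar_neq0.
have cxF : dot c xF - dot c xs <= t * (dot c x - dot c xs) + enorm c * enorm (xt - xF).
  have := dot_CS c (xF - xt); rewrite (formBr (dot_psd n)) enormB.
  rewrite /xt (formDr (dot_psd n)) (formZr (dot_psd n)) (formBr (dot_psd n)).
  by rewrite (Xstar_dot Xu); lra.
have sh2 : Dist xF (Xstar B d c) <=
    (t * (dot c x - dot c xs)) / (mu * enorm c) + enorm (xt - xF) / mu.
  rewrite -(ler_pM2l mu0); apply: le_trans sh _.
  rewrite ler_pdivrMr // (le_trans cxF) // le_eqVlt; apply/orP; left; apply/eqP.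
  by field; rewrite !gt_eqF.
rewrite -(ler_pM2l t0); apply: le_trans Dxt _; apply: le_trans tri _.
apply: le_trans (lerD (lexx _) sh2) _.
have -> : enorm (xt - xF) + (t * (dot c x - dot c xs) / (mu * enorm c) + enorm (xt - xF) / mu)
   = (1 + mu^-1) * enorm (xt - xF) + t * ((dot c x - dot c xs) / (mu * enorm c)).
  by rewrite mulrDl mul1r -mulrA [mu^-1 * _]mulrC; ring.
set Y := (dot c x - dot c xs) / (mu * enorm c).
have -> : t * (th * (1 + mu^-1) * de + Y + e) =
  t * (th * (1 + mu^-1) * de + e) + t * Y by ring.
rewrite lerD2r.
rewrite -DF; apply: le_trans (ler_wpM2l (ltW K0) xtF) _.
have -> : (1 + mu^-1) * ((th + eta) * (t * de)) =
  t * (th * (1 + mu^-1) * de + eta * ((1 + mu^-1) * de)) by ring.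
rewrite ler_pM2l // lerD2l.
have -> : e = eta * ((1 + mu^-1) * de + 1) by rewrite /eta divfK // gt_eqF.
by rewrite ler_pM2l // lerDl.
Qed.

End LPGeometry.

(** * The step-size norm *)
Section StepNorm.
Context {R : realType} {m n : nat} (A : 'M[R]_(m, n)) (tau sigma lam : R).

(** The bilinear form behind [normM]; it is taken for [A] and for [- A].  The
    Lagrangian couples the variables through [- A], so the steps contract in the
    form of [- A], whereas [normM A] measures the balls of the gap. *)
Definition Mform (C : 'M[R]_(m, n)) (z w : 'cV[R]_n * 'cV[R]_m) : R :=
  tau^-1 * dot z.1 w.1 - dot (C *m z.1) w.2 - dot (C *m w.1) z.2
  + sigma^-1 * dot z.2 w.2.

Lemma normME (C : 'M[R]_(m, n)) z : normM C tau sigma z = snorm (Mform C) z.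
Proof.
rewrite /normM /snorm /Mform; congr Num.sqrt.
rewrite /Mmx mul_block_col !mul_scalar_mx dot_col_mx !mulNmx.
rewrite (formDr (dot_psd n)) (formDr (dot_psd m)) (formZr (dot_psd n)).
rewrite (formZr (dot_psd m)) (formNr (dot_psd n)) (formNr (dot_psd m)).
rewrite -dot_mulmx (formC (dot_psd m) z.2); ring.
Qed.

Context (htau : 0 < tau) (hsigma : 0 < sigma).
Context (hlam : forall x : 'cV[R]_n, enorm (A *m x) <= lam * enorm x).
Context (hstep : 4 * tau * sigma * lam ^+ 2 <= 1).

Definition diag_sqnorm (z : 'cV[R]_n * 'cV[R]_m) : R :=
  tau^-1 * dot z.1 z.1 + sigma^-1 * dot z.2 z.2.

Lemma diag_sqnorm_ge0 z : 0 <= diag_sqnorm z.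
Proof.
by rewrite addr_ge0 // mulr_ge0 ?invr_ge0 ?(ltW htau) ?(ltW hsigma) //;
  exact: (form_ge0 (dot_psd _)).
Qed.

Lemma sqr_cross_term_le (x : 'cV[R]_n) (y : 'cV[R]_m) :
  4 * (dot (A *m x) y) ^+ 2 <= (tau^-1 * dot x x) * (sigma^-1 * dot y y).
Proof.
have h1 : dot (A *m x) y ^+ 2 <= (lam * enorm x * enorm y) ^+ 2.
  rewrite -[leLHS]real_normK ?num_real // ler_pXn2r ?nnegrE ?normr_ge0 //.
    by apply: le_trans (dot_CS_norm _ _) _; rewrite ler_wpM2r ?enorm_ge0.
  by rewrite mulr_ge0 ?enorm_ge0 // (le_trans _ (hlam x)) ?enorm_ge0.
have h2 : (lam * enorm x * enorm y) ^+ 2 = lam ^+ 2 * (dot x x * dot y y).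
  by rewrite !exprMn !enormE mulrA.
have h0 : 0 <= dot x x * dot y y.
  by rewrite mulr_ge0 //; exact: (form_ge0 (dot_psd _)).
rewrite mulrACA -invfM ler_pdivlMl ?mulr_gt0 //.
move: h1; rewrite h2; set P := dot x x * dot y y in h0 *; set e := dot _ _ ^+ 2.
have ts : 0 < tau * sigma by rewrite mulr_gt0.
move=> h1; apply: (@le_trans _ _ (tau * sigma * (4 * (lam ^+ 2 * P)))).
  by rewrite ler_pM2l // ler_pM2l // ltr0n.
rewrite -[leRHS]mul1r (_ : _ * _ = 4 * tau * sigma * lam ^+ 2 * P); last by ring.
by rewrite ler_wpM2r.
Qed.

(** Under the step-size condition the coupling is at most half of the diagonal
    part, in either sign; hence the forms of [A] and [- A] are within a factor 3. *)
Lemma cross_term_le C z : C = A \/ C = - A -> 4 * `|dot (C *m z.1) z.2| <= diag_sqnorm z.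
Proof.
move=> hC; have -> : `|dot (C *m z.1) z.2| = `|dot (A *m z.1) z.2|.
  by case: hC => -> //; rewrite mulNmx (formNl (dot_psd m)) normrN.
rewrite -(@ler_pXn2r _ 2) ?nnegrE ?mulr_ge0 ?diag_sqnorm_ge0 ?normr_ge0 // exprMn.
rewrite real_normK ?num_real //.
have := sqr_cross_term_le z.1 z.2; rewrite /diag_sqnorm.
set p := tau^-1 * _; set q := sigma^-1 * _ => h.
have := sqr_ge0 (p - q); rewrite !expr2 in h *; nra.
Qed.

Lemma Mform_psd C : C = A \/ C = - A -> psd_form (Mform C).
Proof.
move=> hC; split=> [u v w|a u w|u v|u]; rewrite /Mform /=.
- rewrite mulmxDr !(formDl (dot_psd _)) (formDr (dot_psd m)); ring.
- rewrite -scalemxAr !(formZl (dot_psd _)) (formZr (dot_psd m)); ring.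
- rewrite (formC (dot_psd n)) (formC (dot_psd m) u.2); ring.
- have := cross_term_le u hC; rewrite /diag_sqnorm.
  have := ler_norm (dot (C *m u.1) u.2); have := normr_ge0 (dot (C *m u.1) u.2).
  by set a := `|_|; lra.
Qed.

Lemma Mform_psd_pos : psd_form (Mform A). Proof. by apply: Mform_psd; left. Qed.
Lemma Mform_psd_opp : psd_form (Mform (- A)). Proof. by apply: Mform_psd; right. Qed.

Lemma Mform_opp z : Mform (- A) z z = Mform A z z + 4 * dot (A *m z.1) z.2.
Proof. by rewrite /Mform !mulNmx !(formNl (dot_psd m)); ring. Qed.

Lemma Mform_diag z : Mform A z z = diag_sqnorm z - 2 * dot (A *m z.1) z.2.
Proof. by rewrite /Mform /diag_sqnorm; ring. Qed.

Let crossA z : - diag_sqnorm z <= 4 * dot (A *m z.1) z.2 <= diag_sqnorm z.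
Proof.
have := cross_term_le z (or_introl erefl).
have := ler_norm (dot (A *m z.1) z.2); have := ler_norm (- dot (A *m z.1) z.2).
by rewrite normrN => h1 h2 h3; apply/andP; split; lra.
Qed.

(** 7/4 is a rational upper bound of [sqrt 3]. *)
Lemma le_of_sqr_le3 (a b : R) : 0 <= a -> 0 <= b -> a ^+ 2 <= 3 * b ^+ 2 -> a <= 7 / 4 * b.
Proof.
move=> a0 b0 h; rewrite -(@ler_pXn2r _ 2) ?nnegrE //; last by lra.
by rewrite exprMn; have := sqr_ge0 b; lra.
Qed.

(** [N - 2t <= 3 (N + 2t)] whenever [4 |t| <= N], for the diagonal part [N] and
    the coupling [t]. *)
Lemma normM_le_oppM z : snorm (Mform A) z <= 7 / 4 * snorm (Mform (- A)) z.
Proof.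
apply: le_of_sqr_le3; rewrite ?snorm_ge0 // (sqr_snorm Mform_psd_pos) (sqr_snorm Mform_psd_opp).
by rewrite Mform_opp Mform_diag; have /andP[] := crossA z; lra.
Qed.

Lemma oppM_le_normM z : snorm (Mform (- A)) z <= 7 / 4 * snorm (Mform A) z.
Proof.
apply: le_of_sqr_le3; rewrite ?snorm_ge0 // (sqr_snorm Mform_psd_pos) (sqr_snorm Mform_psd_opp).
by rewrite Mform_opp Mform_diag; have /andP[] := crossA z; lra.
Qed.

(** Sharper than bounding the form by 3/2 of its diagonal part: the coupling
    costs the product of the two coordinate norms only. *)
Lemma oppM_le_coord z (a b : R) : 0 <= a -> 0 <= b ->
  tau^-1 * dot z.1 z.1 <= a ^+ 2 -> sigma^-1 * dot z.2 z.2 <= b ^+ 2 ->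
  snorm (Mform (- A)) z ^+ 2 <= a ^+ 2 + a * b + b ^+ 2.
Proof.
move=> a0 b0 h1 h2; rewrite (sqr_snorm Mform_psd_opp) Mform_opp Mform_diag /diag_sqnorm.
suff : 2 * dot (A *m z.1) z.2 <= a * b by lra.
apply: le_trans (ler_norm _) _.
rewrite -(@ler_pXn2r _ 2) ?nnegrE ?mulr_ge0 ?normr_ge0 // real_normK ?num_real //.
rewrite !exprMn; have := sqr_cross_term_le z.1 z.2.
have : tau^-1 * dot z.1 z.1 * (sigma^-1 * dot z.2 z.2) <= a ^+ 2 * b ^+ 2.
  by apply: ler_pM; rewrite // mulr_ge0 ?invr_ge0 ?(ltW htau) ?(ltW hsigma) //;
    exact: (form_ge0 (dot_psd _)).
by rewrite expr2; lra.
Qed.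

Lemma snormM_fst (x : 'cV[R]_n) : snorm (Mform A) (x, 0) = enorm x / Num.sqrt tau.
Proof.
rewrite /snorm /Mform /= !(form0r (dot_psd m)) mulr0 !subr0 addr0.
by rewrite sqrtrM ?invr_ge0 ?ltW // sqrtrV ?ltW // mulrC.
Qed.

Lemma snormM_snd (y : 'cV[R]_m) : snorm (Mform A) (0, y) = enorm y / Num.sqrt sigma.
Proof.
rewrite /snorm /Mform /= mulmx0 (form0l (dot_psd n)) (form0l (dot_psd m)) mulr0 !subr0 add0r.
by rewrite sqrtrM ?invr_ge0 ?ltW // sqrtrV ?ltW // mulrC.
Qed.

Lemma snormM_eq0 z : snorm (Mform A) z = 0 -> z = 0.
Proof.
move=> h; have h0 : Mform A z z = 0 by rewrite -(sqr_snorm Mform_psd_pos) h expr0n.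
have N0 : diag_sqnorm z = 0.
  apply/le_anti; rewrite diag_sqnorm_ge0 andbT.
  by have /andP[_] := crossA z; move: h0; rewrite Mform_diag; lra.
have g0 k (u : 'cV[R]_k) : 0 <= dot u u by exact: (form_ge0 (dot_psd k)).
have t0 : 0 < tau^-1 by rewrite invr_gt0.
have s0 : 0 < sigma^-1 by rewrite invr_gt0.
move: N0; rewrite /diag_sqnorm => /eqP.
rewrite paddr_eq0 ?mulr_ge0 ?g0 ?(ltW t0) ?(ltW s0) //.
rewrite !mulf_eq0 (gt_eqF t0) (gt_eqF s0) /= => /andP[/eqP h1 /eqP h2].
by rewrite [z]surjective_pairing (dot_eq0 h1) (dot_eq0 h2).
Qed.

End StepNorm.

(** * Averages of primal-dual steps *)
Section PDHG.
Context {R : realType} {m n : nat} (A : 'M[R]_(m, n)) (b : 'cV[R]_m) (c : 'cV[R]_n).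
Context (tau sigma lam : R).
Context (htau : 0 < tau) (hsigma : 0 < sigma).
Context (hlam : forall x : 'cV[R]_n, enorm (A *m x) <= lam * enorm x).
Context (hstep : 4 * tau * sigma * lam ^+ 2 <= 1).

Local Notation Z := ('cV[R]_n * 'cV[R]_m)%type.
Local Notation fP := (Mform tau sigma A).
Local Notation fN := (Mform tau sigma (- A)).
Local Notation step := (pdhg_step A b c tau sigma).
Let pP : psd_form fP := Mform_psd_pos htau hsigma hlam hstep.
Let pN : psd_form fN := Mform_psd_opp htau hsigma hlam hstep.

Lemma variational_ineq k (K : set 'cV[R]_k) v p :
  (forall u w t, K u -> K w -> 0 <= t <= 1 -> K (u + t *: (w - u))) ->
  K p -> (forall u, K u -> enorm (v - p) <= enorm (v - u)) ->
  forall u, K u -> dot (v - p) (u - p) <= 0.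
Proof.
move=> convK Kp hp u Ku; rewrite leNgt; apply/negP => g0.
set g := dot _ _ in g0; pose q := dot (u - p) (u - p).
have q0 : 0 <= q by exact: (form_ge0 (dot_psd k)).
(* Nearly the minimizer of the distance along the segment; the 1 guards against
   [q = 0]. *)
pose t := Num.min 1 (g / (q + 1)).
have t0 : 0 < t by rewrite lt_min ltr01 divr_gt0 // ltr_wpDl.
have tq : t * (q + 1) <= g by rewrite -ler_pdivlMr ?ltr_wpDl // ge_min lexx orbT.
have := hp _ (convK p u t Kp Ku _); rewrite ltW // ge_min lexx => /(_ isT).
rewrite enorm_le_sqr opprD addrA -scalerN (form_sqrD (dot_psd k)).
rewrite (formNr (dot_psd k)) (formNr (dot_psd k)) (formNl (dot_psd k)) opprK -/g -/q.
have : t * (q * t) < t * g; last by rewrite expr2; nra.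
by rewrite ltr_pM2l // mulrC; nra.
Qed.

Lemma orthant_convex k (u w : 'cV[R]_k) t :
  orthant u -> orthant w -> 0 <= t <= 1 -> orthant (u + t *: (w - u)).
Proof.
move=> hu hw /andP[t0 t1] i; rewrite !mxE.
have -> : u i 0 + t * (w i 0 - u i 0) = (1 - t) * u i 0 + t * w i 0 by ring.
by rewrite addr_ge0 ?mulr_ge0 // subr_ge0.
Qed.

Lemma eproj_orthantP k (v : 'cV[R]_k) :
  orthant (eproj orthant v) /\
  forall u, orthant u -> dot (v - eproj orthant v) (u - eproj orthant v) <= 0.
Proof.
have FpE : Fp (0 : 'M[R]_(0, k)) 0 = orthant.
  by apply/seteqP; split=> x; [case|split; rewrite // /Vp /= mul0mx].
have [|u [hu hmin]] := @closest_point _ _ _ (0 : 'M[R]_(0, k)) 0 v.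
  by rewrite FpE; exact: orthant_neq0.
rewrite FpE in hu hmin.
have [h1 h2] : [set p | orthant p /\ forall u, orthant u ->
    enorm (v - p) <= enorm (v - u)] (eproj orthant v).
  by apply: xgetPex; exists u.
split=> //; apply: variational_ineq => //; exact: orthant_convex.
Qed.

Definition gap (z zh : Z) : R :=
  Lagrangian A b c z.1 zh.2 - Lagrangian A b c zh.1 z.2.

Definition grad_gap (z d : Z) : R :=
  dot (b - A *m z.1) d.2 - dot (c - A^T *m z.2) d.1.

Lemma gapE z zh : gap z zh = grad_gap z (zh - z).
Proof.
rewrite /gap /grad_gap /Lagrangian /=.
rewrite !(formBl (dot_psd _)) !(formBr (dot_psd _)) -!dot_mulmx.
rewrite (formC (dot_psd n) (A^T *m z.2)) (formC (dot_psd n) (A^T *m z.2) z.1).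
by rewrite -!dot_mulmx; ring.
Qed.

Lemma grad_gapZ z t d : grad_gap z (t *: d) = t * grad_gap z d.
Proof. by rewrite /grad_gap /= !(formZr (dot_psd _)); ring. Qed.

(** The gap is affine in its first argument. *)
Lemma gap_avg (k : nat) (z : nat -> Z) zh : (0 < k)%N ->
  k%:R * gap (k%:R^-1 *: \sum_(1 <= i < k.+1) z i) zh = \sum_(1 <= i < k.+1) gap (z i) zh.
Proof.
move=> k0; have kn : k%:R != 0 :> R by rewrite pnatr_eq0 -lt0n.
pose al (w : Z) := dot c w.1 - dot w.1 (A^T *m zh.2) - dot b w.2 + dot zh.1 (A^T *m w.2).
have gE w : gap w zh = al w + (dot b zh.2 - dot c zh.1).
  by rewrite /gap /al /Lagrangian; ring.
have alD w w' : al (w + w') = al w + al w'.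
  rewrite /al /= mulmxDr !(formDl (dot_psd _)) !(formDr (dot_psd _)); ring.
have alZ t w : al (t *: w) = t * al w.
  rewrite /al /= -scalemxAr !(formZl (dot_psd _)) !(formZr (dot_psd _)); ring.
rewrite gE (eq_bigr _ (fun i _ => gE (z i))) big_split /= alZ mulrDr mulrA divff // mul1r.
congr (_ + _).
  elim/big_rec2 : _ => [|i x y _ <-]; last by rewrite alD.
  by have := alZ 0 0; rewrite scale0r mul0r.
by rewrite sumr_const_nat subn1 /= mulr_natl.
Qed.

Lemma pdhg_step_orthant z : orthant (step z).1.
Proof. by have [] := eproj_orthantP (z.1 - tau *: (c - A^T *m z.2)). Qed.

(** The proximal inequality: the optimality condition of the projection and the
    explicit dual update express the gap at the new point as an inner product in
    the form of [- A]; the extrapolation of [x] makes the coupling terms match. *)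
Lemma pdhg_step_gap z zh : orthant zh.1 ->
  2 * gap (step z) zh <=
  fN (zh - z) (zh - z) - fN (zh - step z) (zh - step z) - fN (step z - z) (step z - z).
Proof.
move=> hzh; rewrite -(form_polar pN) ler_pM2l // gapE.
set z' := step z; set dx := z'.1 - z.1; set dy := z'.2 - z.2.
set h := zh.1 - z'.1; set k := zh.2 - z'.2.
have prj : dot (z.1 - tau *: (c - A^T *m z.2) - z'.1) h <= 0.
  by have [_] := eproj_orthantP (z.1 - tau *: (c - A^T *m z.2)); exact.
have dyE : sigma^-1 *: dy = b - A *m (2 *: z'.1 - z.1).
  by rewrite /dy /z' /= addrC addrA addNr add0r scalerA mulVf ?scale1r // gt_eqF.
have e1 : b - A *m z'.1 = sigma^-1 *: dy + A *m dx.
  by rewrite dyE /dx !mulmxBr -scalemxAr scaler_nat mulr2n; apply/colP => i; rewrite !mxE; ring.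
have e2 : c - A^T *m z'.2 = c - A^T *m z.2 - A^T *m dy.
  by rewrite /dy mulmxBr; apply/colP => i; rewrite !mxE; ring.
rewrite /grad_gap e1 e2 -/h -/k /Mform /= -/dx -/dy -/h -/k.
have prj2 : - dot (c - A^T *m z.2) h <= tau^-1 * dot dx h.
  rewrite ler_pdivlMl //; move: prj; rewrite addrAC.
  have -> : z.1 - z'.1 = - dx by rewrite opprB.
  by rewrite (formBl (dot_psd n)) (formZl (dot_psd n)) (formNl (dot_psd n)); lra.
rewrite (formBl (dot_psd n) _ (A^T *m dy)) (formDl (dot_psd m)) (formZl (dot_psd m)).
rewrite (dot_mulmx A^T) trmxK !mulNmx !(formNl (dot_psd m)).
rewrite (formC (dot_psd m) (A *m h) dy).
by lra.
Qed.

Lemma pdhg_sum_gap z zh k : orthant zh.1 -> (0 < k)%N ->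
  2 * k%:R * gap (pdhg_avg A b c tau sigma z k) zh <=
  fN (zh - z) (zh - z) - fN (zh - iter k step z) (zh - iter k step z).
Proof.
move=> hzh k0; rewrite -mulrA /pdhg_avg gap_avg // mulr_sumr.
elim: k {k0} => [|k IH]; first by rewrite big_geq //= subrr.
rewrite big_nat_recr //= .
have := pdhg_step_gap (iter k step z) hzh.
have := form_ge0 pN (step (iter k step z) - iter k step z).
by move: IH; lra.
Qed.

Definition saddle_point (zs : Z) := orthant zs.1 /\
  forall z : Z, orthant z.1 -> 0 <= gap z zs.

Lemma iter_fejer z zs k : saddle_point zs ->
  snorm fN (iter k step z - zs) <= snorm fN (z - zs).
Proof.
move=> [hzs hs]; elim: k => [|k IH] //=; apply: le_trans IH.
rewrite -(@ler_pXn2r _ 2) ?nnegrE ?snorm_ge0 // !(sqr_snorm pN).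
have := pdhg_step_gap (iter k step z) hzs.
have := form_ge0 pN (step (iter k step z) - iter k step z).
have := hs _ (pdhg_step_orthant (iter k step z)).
have sq u v : fN (u - v) (u - v) = fN (v - u) (v - u).
  by rewrite -opprB (formNl pN) (formNr pN) opprK.
by rewrite (sq zs) [fN (zs - _) _]sq; lra.
Qed.

Lemma avg_fejer z zs k : saddle_point zs -> (0 < k)%N ->
  snorm fN (pdhg_avg A b c tau sigma z k - zs) <= snorm fN (z - zs).
Proof.
move=> hs k0; have kn : k%:R != 0 :> R by rewrite pnatr_eq0 -lt0n.
have kp : 0 < k%:R :> R by rewrite ltr0n.
rewrite /pdhg_avg.
have zsE : zs = k%:R^-1 *: \sum_(1 <= i < k.+1) zs.
  by rewrite sumr_const_nat subn1 /= -[X in _ = _ *: X]scaler_nat scalerA mulVf // scale1r.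
rewrite [X in snorm _ (_ *: _ - X)]zsE -scalerBr -sumrB (snormZ pN) ger0_norm ?invr_ge0 ?ler0n //.
rewrite ler_pdivrMl //.
apply: (@le_trans _ _ (\sum_(1 <= i < k.+1) snorm fN (z - zs))).
  elim/big_rec2 : _ => [|i x y _ h]; first by rewrite (snorm0 pN).
  apply: le_trans (snormD pN _ _) _; rewrite lerD //.
  exact: iter_fejer.
rewrite sumr_const_nat subn1 /= mulr_natl.
by [].
Qed.

Lemma avg_orthant z k : orthant (pdhg_avg A b c tau sigma z k).1.
Proof.
rewrite /pdhg_avg /=; apply: orthantZ; first by rewrite invr_ge0.
have : forall r : seq nat, all (fun i => 0 < i)%N r ->
    orthant (\sum_(i <- r) iter i step z).1.
  elim=> [_|i r IH] /=; first by rewrite big_nil; exact: (@orthant0 R n).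
  move=> /andP[i0 /IH hr]; rewrite big_cons /=; apply: orthantD => //.
  by case: i i0 => //= i _; exact: pdhg_step_orthant.
apply; apply/allP => i; rewrite mem_index_iota => /andP[] //.
Qed.

(** After telescoping, the difference of squares splits as twice the inner
    product of [zk - z] and [zh - zb], plus squares of which only that of [zb - z]
    counts.  Both terms are products of a length at most [2 D], by Fejer
    monotonicity, and a length comparable to the radius. *)
Lemma avg_gap_bound z zs zh k : saddle_point zs -> (0 < k)%N -> orthant zh.1 ->
  let zb := pdhg_avg A b c tau sigma z k in
  snorm fP (zh - zb) <= snorm fP (zb - z) ->
  gap zb zh <= snorm fP (zb - z) * (21 / 4 * snorm fN (z - zs) / k%:R).
Proof.
move=> hs k0 hzh zb hr; set r := snorm fP (zb - z) in hr *.
set D := snorm fN (z - zs); have kp : 0 < k%:R :> R by rewrite ltr0n.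
rewrite mulrA ler_pdivlMr //.
have := pdhg_sum_gap z hzh k0; rewrite -/zb; set zk := iter k step z.
have D0 : 0 <= D by exact: snorm_ge0.
have r0 : 0 <= r by exact: snorm_ge0.
have zkz : snorm fN (zk - z) <= 2 * D.
  have := snorm_triangle pN zk zs z; rewrite [snorm fN (zs - z)](snormB pN) -/D.
  by have := iter_fejer z k hs; rewrite -/zk -/D; lra.
have zbz : snorm fN (zb - z) <= 2 * D.
  have := snorm_triangle pN zb zs z; rewrite [snorm fN (zs - z)](snormB pN) -/D.
  by have := avg_fejer z hs k0; rewrite -/zb -/D; lra.
have zbr : snorm fN (zb - z) <= 7 / 4 * r := oppM_le_normM htau hsigma hlam hstep _.
have zhr : snorm fN (zh - zb) <= 7 / 4 * r.
  apply: le_trans (oppM_le_normM htau hsigma hlam hstep _) _.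
  by rewrite ler_pM2l //; lra.
have e : fN (zh - z) (zh - z) - fN (zh - zk) (zh - zk) =
   2 * fN (zk - z) (zh - zb) + fN (zb - z) (zb - z) - fN (zb - zk) (zb - zk).
  rewrite !(formBl pN) !(formBr pN) (formC pN zk zh) (formC pN z zh).
  by rewrite (formC pN zk zb) (formC pN z zb); ring.
rewrite e; have := form_ge0 pN (zb - zk).
have h1 : fN (zk - z) (zh - zb) <= 2 * D * (7 / 4 * r).
  apply: le_trans (form_CS pN _ _) _.
  by apply: ler_pM; rewrite ?snorm_ge0.
have h2 : fN (zb - z) (zb - z) <= 2 * D * (7 / 4 * r).
  rewrite -(sqr_snorm pN) expr2.
  by apply: ler_pM; rewrite ?snorm_ge0.
by rewrite -/zb -/D; lra.
Qed.

Lemma rho_avg_le z zs k : saddle_point zs -> (0 < k)%N ->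
  rho A b c tau sigma (normM A tau sigma (pdhg_avg A b c tau sigma z k - z))
      (pdhg_avg A b c tau sigma z k)
    <= 21 / 4 * snorm fN (z - zs) / k%:R.
Proof.
move=> hs k0; set zb := pdhg_avg _ _ _ _ _ _ _; rewrite /rho normME.
have D0 := snorm_ge0 fN (z - zs).
have kp : 0 < k%:R :> R by rewrite ltr0n.
have := snorm_ge0 fP (zb - z); rewrite le_eqVlt => /orP[/eqP <-|r0].
  by rewrite invr0 mul0r divr_ge0 ?ler0n // mulr_ge0 //; lra.
rewrite ler_pdivrMl //; apply: ge_sup.
  exists (gap zb zb), zb => //; split; first exact: avg_orthant.
  by rewrite subrr normME (snorm0 pP) ltW.
move=> _ [zh [hzh hr] <-]; apply: avg_gap_bound => //.
by rewrite -normME.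
Qed.

Lemma grad_gap_le z d :
  grad_gap z d <= (enorm (b - A *m z.1) * Num.sqrt sigma
     + enorm (c - A^T *m z.2) * Num.sqrt tau) * (2 * snorm fP d).
Proof.
have hd := sqr_snorm pP d; rewrite Mform_diag /diag_sqnorm in hd.
have hc := cross_term_le htau hsigma hlam hstep d (or_introl erefl).
have st : 0 < Num.sqrt tau by rewrite sqrtr_gt0.
have ss : 0 < Num.sqrt sigma by rewrite sqrtr_gt0.
have g0 k (u : 'cV[R]_k) : 0 <= dot u u by exact: (form_ge0 (dot_psd k)).
have sn := snorm_ge0 fP d; set S := snorm fP d in hd sn *.
have hN : diag_sqnorm tau sigma d <= 2 * S ^+ 2.
  rewrite hd; have := ler_norm (dot (A *m d.1) d.2); move: hc; rewrite /diag_sqnorm; lra.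
have hx : enorm d.1 <= Num.sqrt tau * (2 * S).
  rewrite -(@ler_pXn2r _ 2) ?nnegrE ?enorm_ge0 // ?mulr_ge0 ?(ltW st) //.
  rewrite enormE exprMn sqr_sqrtr ?(ltW htau) // -ler_pdivrMl //.
  move: hN; rewrite /diag_sqnorm.
  have : 0 <= sigma^-1 * dot d.2 d.2 by rewrite mulr_ge0 ?g0 // invr_ge0 ltW.
  by have := sqr_ge0 S; rewrite exprMn; lra.
have hy : enorm d.2 <= Num.sqrt sigma * (2 * S).
  rewrite -(@ler_pXn2r _ 2) ?nnegrE ?enorm_ge0 // ?mulr_ge0 ?(ltW ss) //.
  rewrite enormE exprMn sqr_sqrtr ?(ltW hsigma) // -ler_pdivrMl //.
  move: hN; rewrite /diag_sqnorm.
  have : 0 <= tau^-1 * dot d.1 d.1 by rewrite mulr_ge0 ?g0 // invr_ge0 ltW.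
  by have := sqr_ge0 S; rewrite exprMn; lra.
rewrite /grad_gap mulrDl; apply: lerD.
  by apply: le_trans (dot_CS _ _) _; rewrite -mulrA ler_wpM2l ?enorm_ge0.
rewrite -(formNr (dot_psd n)); apply: le_trans (dot_CS _ _) _.
by rewrite enormN -mulrA ler_wpM2l ?enorm_ge0.
Qed.

Lemma gap_le_rho r z zh : 0 < r -> orthant zh.1 -> snorm fP (zh - z) <= r ->
  gap z zh <= r * rho A b c tau sigma r z.
Proof.
move=> r0 hzh hr; rewrite /rho mulrA divff ?gt_eqF // mul1r.
apply: ub_le_sup; last by exists zh => //; split; rewrite // normME.
exists ((enorm (b - A *m z.1) * Num.sqrt sigma
     + enorm (c - A^T *m z.2) * Num.sqrt tau) * (2 * r)).
move=> y [w [_ hw] <-]; rewrite -/(gap z w) gapE.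
apply: le_trans (grad_gap_le _ _) _; rewrite ler_wpM2l //.
  by rewrite addr_ge0 // mulr_ge0 ?enorm_ge0 ?sqrtr_ge0.
by rewrite ler_pM2l // -normME.
Qed.

(** A normalized gap at most [q] for radius [r], as a bound that makes sense for
    [q = 0], where it characterizes saddle points among the pairs with
    nonnegative [x]. *)
Definition gap_bounded (r q : R) (z : Z) : Prop :=
  forall zh : Z, orthant zh.1 -> snorm fP (zh - z) <= r -> gap z zh <= r * q.

Lemma gap_bounded_ge0 r q z : 0 < r -> orthant z.1 -> gap_bounded r q z -> 0 <= q.
Proof.
move=> r0 hz h; have := h z hz; rewrite subrr (snorm0 pP) => /(_ (ltW r0)).
by rewrite gapE subrr /grad_gap /= !(form0r (dot_psd _)) subrr pmulr_rge0.
Qed.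

(** Outside the ball, move from [z] towards [zh] only as far as the radius; the
    gap is linear along the segment. *)
Lemma gap_bounded_scale r q z zh : 0 < r -> orthant z.1 -> gap_bounded r q z ->
  orthant zh.1 -> gap z zh <= q * Num.max r (snorm fP (zh - z)).
Proof.
move=> r0 hz h hzh; have q0 := gap_bounded_ge0 r0 hz h.
set S := snorm fP (zh - z); case: (leP S r) => hS.
  by rewrite mulrC; exact: h.
have S0 : 0 < S by exact: lt_trans hS.
pose t := r / S.
have t0 : 0 < t by rewrite divr_gt0.
have t1 : 0 <= t <= 1 by rewrite ltW //= ler_pdivrMr // mul1r ltW.
have hyp : gap z (z + t *: (zh - z)) <= r * q.
  apply: h; first exact: orthant_convex.
  by rewrite addrC addKr (snormZ pP) gtr0_norm // divfK // gt_eqF.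
move: hyp; rewrite gapE [X in grad_gap _ X]addrC addKr grad_gapZ -gapE.
by rewrite /t mulrAC ler_pdivrMr // mulrAC -mulrA ler_pM2l // mulrC.
Qed.

Lemma gap_bounded_ray r q z d : 0 < r -> gap_bounded r q z ->
  (forall t, 0 <= t -> orthant (z.1 + t *: d.1)) -> snorm fP d != 0 ->
  grad_gap z d <= q * snorm fP d.
Proof.
move=> r0 h hd S0; have Sp : 0 < snorm fP d by rewrite lt_def S0 snorm_ge0.
pose t := r / snorm fP d.
have t0 : 0 < t by rewrite divr_gt0.
have hyp : gap z (z + t *: d) <= r * q.
  apply: h; first exact/hd/ltW.
  by rewrite addrC addKr (snormZ pP) gtr0_norm // divfK.
move: hyp; rewrite gapE [X in grad_gap _ X]addrC addKr grad_gapZ.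
by rewrite /t mulrAC ler_pdivrMr // -mulrA ler_pM2l.
Qed.

(** The gap grows at rate [enorm (b - A x)] when only the dual variable moves,
    along the residual. *)
Lemma gap_bounded_primal_residual r q z : 0 < r -> orthant z.1 -> gap_bounded r q z ->
  enorm (A *m z.1 - b) <= q / Num.sqrt sigma.
Proof.
move=> r0 hz h; have q0 := gap_bounded_ge0 r0 hz h.
have ss : 0 < Num.sqrt sigma by rewrite sqrtr_gt0.
rewrite enormB; have [->|u0] := eqVneq (b - A *m z.1) 0.
  by rewrite [leLHS](snorm0 (dot_psd m)) divr_ge0 // ltW.
have up := enorm_gt0 u0.
have nE := @snormM_snd _ _ _ A _ _ hsigma (b - A *m z.1).
have := @gap_bounded_ray r q z (0, b - A *m z.1) r0 h.
rewrite nE /grad_gap /= (form0r (dot_psd n)) subr0 -enormE => hray.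
rewrite -(ler_pM2l up) -expr2 mulrCA; apply: hray.
  by move=> t t0; rewrite scaler0 addr0.
by rewrite mulf_neq0 ?invr_eq0 ?gt_eqF.
Qed.

Lemma orthant_parts k (s : 'cV[R]_k) : exists sp sn : 'cV[R]_k,
  [/\ orthant sp, orthant sn, s = sp - sn & dot sp sn = 0].
Proof.
exists (\col_i Num.max 0 (s i 0)), (\col_i Num.max 0 (- s i 0)); split.
- by move=> i; rewrite mxE le_max lexx.
- by move=> i; rewrite mxE le_max lexx.
- apply/colP => i; rewrite !mxE.
  by case: (leP 0 (s i 0)); case: (leP 0 (- s i 0)); lra.
- rewrite /dot big1 // => i _; rewrite !mxE.
  case: (leP 0 (s i 0)); case: (leP 0 (- s i 0)) => h1 h2; rewrite ?mul0r ?mulr0 //.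
  by have -> : s i 0 = 0; [lra|rewrite mul0r].
Qed.

(** The gap grows when only the primal variable moves along the negative part of
    the reduced cost, a direction that never leaves the orthant. *)
Lemma gap_bounded_dual_residual r q z : 0 < r -> orthant z.1 -> gap_bounded r q z ->
  Dist (c - A^T *m z.2) orthant <= q / Num.sqrt tau.
Proof.
move=> r0 hz h; have q0 := gap_bounded_ge0 r0 hz h.
have st : 0 < Num.sqrt tau by rewrite sqrtr_gt0.
set s := c - A^T *m z.2.
have [sp [sn [hsp hsn sE spn]]] := orthant_parts s.
apply: le_trans (Dist_le s hsp) _.
have -> : s - sp = - sn by rewrite sE addrAC subrr add0r.
rewrite enormN; have [->|u0] := eqVneq sn 0.
  by rewrite [leLHS](snorm0 (dot_psd n)) divr_ge0 // ltW.
have up := enorm_gt0 u0.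
have nE := @snormM_fst _ _ _ A _ _ htau sn.
have := @gap_bounded_ray r q z (sn, 0) r0 h.
rewrite nE /grad_gap /= (form0r (dot_psd m)) sub0r -/s.
rewrite {1}sE (formBl (dot_psd n)) spn sub0r opprK -enormE => hray.
rewrite -(ler_pM2l up) -expr2 mulrCA; apply: hray.
  by move=> t t0; apply: orthantD => //; exact: orthantZ.
by rewrite mulf_neq0 ?invr_eq0 ?gt_eqF.
Qed.

End PDHG.

(** * The primal-dual pair *)
Section PrimalDual.
Context {R : realType} {m n : nat} (A : 'M[R]_(m, n)) (b : 'cV[R]_m) (c : 'cV[R]_n).

(** Its kernel is the range of [A^T]; with it the dual program in the slack
    variable becomes a primal program with objective [qvec A b], and every result
    on primal programs applies to the dual. *)
Definition dual_mx : 'M[R]_n := (cokermx A)^T.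

Lemma dual_mxP (v : 'cV[R]_n) : dual_mx *m v = 0 <-> exists y : 'cV[R]_m, v = A^T *m y.
Proof.
split=> [/(congr1 trmx)|[y ->]]; last first.
  by rewrite mulmxA -trmx_mul mulmx_coker trmx0 mul0mx.
rewrite trmx_mul trmxK trmx0 => /eqP; rewrite -submxE => /submxP[D hD].
by exists D^T; rewrite -trmx_mul -hD trmxK.
Qed.

Lemma VdE : Vd A c = Vp dual_mx (dual_mx *m c).
Proof.
apply/seteqP; split=> [_ [y _ <-]|s hs].
  rewrite /Vp /= mulmxDr; have -> : dual_mx *m (A^T *m y) = 0; last by rewrite addr0.
  by apply/dual_mxP; exists y.
have /dual_mxP[y hy] : dual_mx *m (s - c) = 0 by rewrite mulmxBr hs subrr.
by exists y => //; rewrite -hy addrC subrK.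
Qed.

Lemma FdE : Fd A c = Fp dual_mx (dual_mx *m c).
Proof. by rewrite /Fd VdE. Qed.

Lemma SstarE : Sstar A b c = Xstar dual_mx (dual_mx *m c) (qvec A b).
Proof.
rewrite /Sstar FdE; apply/seteqP; split=> s [Fs h]; split=> // s' /h;
  by rewrite !(formBr (dot_psd n)); lra.
Qed.

Lemma HdE : Hd A b c = Hp dual_mx (dual_mx *m c) (qvec A b).
Proof.
rewrite /Hd /Hp SstarE; apply/seteqP; split=> s [s' hs' e]; exists s' => //;
  by move: e; rewrite !(formBr (dot_psd n)); lra.
Qed.

Lemma mu_dE : mu_d A b c = mu_p dual_mx (dual_mx *m c) (qvec A b).
Proof. by rewrite /mu_d /mu_p VdE HdE FdE SstarE. Qed.

Lemma theta_dE : theta_d A b c = theta_p dual_mx (dual_mx *m c) (qvec A b).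
Proof. by rewrite /theta_d /theta_p VdE SstarE. Qed.

Lemma qvec_range : exists w : 'cV[R]_m, qvec A b = A^T *m w.
Proof. by exists (pinv (A *m A^T) *m b); rewrite /qvec mulmxA. Qed.

Lemma gram_pinv_range (w : 'cV[R]_n) :
  A *m (A^T *m (pinv (A *m A^T) *m (A *m w))) = A *m w.
Proof. by rewrite !mulmxA (gram_pinv A).1. Qed.

Context (hLP : LP_assumption A b c) (hc : A *m c = 0).

Lemma mul_qvec : A *m qvec A b = b.
Proof.
have [[x [[Ax _] _]] _ _] := hLP.
by rewrite /qvec -mulmxA -[in LHS]Ax gram_pinv_range.
Qed.

Lemma dot_qvec y : dot (qvec A b) (A^T *m y) = dot b y.
Proof. by rewrite -dot_mulmx mul_qvec. Qed.

Lemma dot_c_range y : dot c (A^T *m y) = 0.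
Proof. by rewrite -dot_mulmx hc (form0l (dot_psd m)). Qed.

Lemma dot_qvec_c : dot (qvec A b) c = 0.
Proof. by have [w ->] := qvec_range; rewrite (formC (dot_psd n)) dot_c_range. Qed.

Lemma dual_mx_qvec : dual_mx *m qvec A b = 0.
Proof. by apply/dual_mxP; exact: qvec_range. Qed.

Lemma dual_optimum xs : Xstar A b c xs -> exists ss, Sstar A b c ss.
Proof.
move=> hxs; have [y [hy hb]] := strong_duality hxs; exists (c - A^T *m y).
have Vs : Vd A c (c - A^T *m y) by exists (- y) => //; rewrite mulmxN.
split; first by split.
move=> _ [[y' _ <-] hs']; rewrite opprB addrCA subrr addr0 dot_qvec.
rewrite opprD addrA subrr add0r (formNr (dot_psd n)) dot_qvec.
apply: le_trans hb; have [[Ax x0] _] := hxs.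
have := dot_ge0 x0 hs'; rewrite (formDr (dot_psd n)) -dot_mulmx Ax.
by rewrite (formC (dot_psd n) xs); lra.
Qed.

Lemma optimal_values xs ss : Xstar A b c xs -> Sstar A b c ss ->
  dot (qvec A b) ss = - dot c xs.
Proof.
move=> hxs [[[y _ <-] s0] hopt]; have [y' [hy' hb']] := strong_duality hxs.
have [[Ax x0] _] := hxs.
rewrite (formDr (dot_psd n)) dot_qvec_c add0r dot_qvec.
have := dot_ge0 x0 s0; rewrite (formDr (dot_psd n)) -dot_mulmx Ax (formC (dot_psd n) xs).
have Vs : Vd A c (c - A^T *m y') by exists (- y') => //; rewrite mulmxN.
have := hopt _ (conj Vs hy'); rewrite opprB addrCA subrr addr0 dot_qvec.
rewrite opprD addrA subrr add0r (formNr (dot_psd n)) dot_qvec.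
by move: hb'; lra.
Qed.

Lemma saddle_point_of_optima xs y : Xstar A b c xs -> Sstar A b c (c - A^T *m y) ->
  saddle_point A b c (xs, y).
Proof.
move=> hxs hs; have [[Ax x0] _] := hxs; split=> // z hz.
have := optimal_values hxs hs; rewrite (formBr (dot_psd n)) dot_qvec_c dot_qvec sub0r.
move=> /oppr_inj e.
have [[_ s0] _] := hs; have := dot_ge0 hz s0; rewrite (formBr (dot_psd n)).
rewrite /gap /Lagrangian /= -[dot xs (A^T *m _)]dot_mulmx Ax (formC (dot_psd n) z.1 c).
by move: e; lra.
Qed.

Let q := qvec A b.

Lemma primal_data : [/\ 0 < mu_p A b c, mu_p A b c <= 1, 1 <= theta_p A b c & c != 0].
Proof.
have [[xs hxs] hn _] := hLP; split.
- exact: mu_p_gt0 hxs hn.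
- exact: mu_p_le1 hxs hn.
- exact: theta_p_ge1 hxs.
- exact: objective_neq0 hxs hn.
Qed.

Lemma dual_data : [/\ 0 < mu_d A b c, mu_d A b c <= 1, 1 <= theta_d A b c & q != 0].
Proof.
have [[xs hxs] _ hn] := hLP; have [ss hss] := dual_optimum hxs.
rewrite SstarE in hss; rewrite FdE SstarE in hn; rewrite mu_dE theta_dE; split.
- exact: mu_p_gt0 hss hn.
- exact: mu_p_le1 hss hn.
- exact: theta_p_ge1 hss.
- exact: objective_neq0 hss hn.
Qed.

Lemma A_neq0 : A != 0.
Proof.
have [_ _ _] := dual_data; apply: contra => /eqP A0.
by have [w] := qvec_range; rewrite -/q A0 trmx0 mul0mx => ->.
Qed.

Let lmin := lambda_min A.
Let lmax := lambda_max A.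

Lemma singular_data : [/\ 0 < lmin, lmin <= lmax, 0 < lmax & 1 <= kappa A].
Proof.
have [h1 h2 _ _] := singular_value_bounds A_neq0; split=> //.
  exact: lt_le_trans h2.
by rewrite /kappa ler_pdivlMr // mul1r.
Qed.

Let tau := tau_step A b c.
Let sigma := sigma_step A b c.

Lemma step_data : [/\ 0 < tau, 0 < sigma & tau * sigma = (4 * lmax ^+ 2)^-1].
Proof.
have [mp _ _ /enorm_gt0 c0] := primal_data; have [md _ _ /enorm_gt0 q0] := dual_data.
have [l0 _ L0 k1] := singular_data; have k0 : 0 < kappa A by exact: lt_le_trans k1.
split.
- by rewrite /tau /tau_step -/q divr_gt0 ?mulr_gt0 ?invr_gt0 ?ltr0n.
- by rewrite /sigma /sigma_step -/q -/lmin -/lmax divr_gt0 ?mulr_gt0 ?ltr0n.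
rewrite /tau /sigma /tau_step /sigma_step /kappa -/lmin -/lmax -/q.
by field; rewrite !gt_eqF.
Qed.

Lemma step_ineq : 4 * tau * sigma * lmax ^+ 2 <= 1.
Proof.
have [_ _ e] := step_data; have [_ _ L0 _] := singular_data.
have -> : 4 * tau * sigma * lmax ^+ 2 = 4 * lmax ^+ 2 * (tau * sigma) by ring.
by rewrite e divff // gt_eqF // mulr_gt0 ?ltr0n ?exprn_gt0.
Qed.

(** The preimage in the range of [A] is the short one: for it the smallest
    nonzero singular value of [A^T] is a lower bound as well. *)
Lemma preimage_bound (v : 'cV[R]_n) : (exists w : 'cV[R]_m, v = A^T *m w) ->
  exists y : 'cV[R]_m, A^T *m y = v /\ lmin * enorm y <= enorm v.
Proof.
move=> [w ->]; pose P := pinv (A *m A^T).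
pose u := A^T *m (P *m w).
exists (A *m u); have e : A^T *m (A *m u) = A^T *m w.
  by rewrite /u !mulmxA -[A^T *m A *m A^T]mulmxA -mulmxA mulmxA -[_ *m P]mulmxA (gram_pinv A).2.
split=> //; have [l0 _ _ _] := singular_data.
have [_ _ _ hmin] := singular_value_bounds A_neq0.
have hu := hmin (P *m w); rewrite -/u -/lmin in hu.
have [->|y0] := eqVneq (A *m u) 0.
  by rewrite [enorm 0](snorm0 (dot_psd m)) mulr0 enorm_ge0.
have yp := enorm_gt0 y0.
have h1 : enorm (A *m u) ^+ 2 <= enorm u * enorm (A^T *m w).
  by rewrite enormE dot_mulmx e; exact: dot_CS.
rewrite -(ler_pM2l yp) mulrCA -expr2.
apply: le_trans (ler_wpM2l (ltW l0) h1) _.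
by rewrite mulrA ler_wpM2r ?enorm_ge0.
Qed.

Lemma Dist0_Vp : Dist 0 (Vp A b) = enorm q.
Proof.
have [_ _ _ /enorm_gt0 q0] := dual_data.
rewrite (Dist_eq (u := q)); rewrite ?sub0r ?enormN //; first exact: mul_qvec.
move=> x Vx; rewrite !sub0r !enormN -(ler_pM2l q0) -expr2 enormE.
apply: le_trans (dot_CS q x); have [w hw] := qvec_range.
have e z : dot q z = dot w (A *m z) by rewrite /q hw dot_mulmx trmxK.
by rewrite !e mul_qvec Vx.
Qed.

Lemma Dist0_Vd : Dist 0 (Vd A c) = enorm c.
Proof.
have [_ _ _ /enorm_gt0 c0] := primal_data.
rewrite (Dist_eq (u := c)); rewrite ?sub0r ?enormN //.
  by exists 0 => //; rewrite mulmx0 addr0.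
move=> _ [y _ <-]; rewrite !sub0r !enormN -(ler_pM2l c0) -expr2 enormE.
by apply: le_trans (dot_CS _ _); rewrite (formDr (dot_psd n)) dot_c_range addr0.
Qed.

End PrimalDual.

(** * From the normalized gap to the distance to optima *)

(** The form [a^2 + a e + e^2] is the square of a norm on the plane whose value
    at [(H, H)] is [sqrt 3 * H]; the triangle inequality for the splitting
    [(U, 0) + (0, V) + (H, H)] gives the bound, with 7/4 in place of [sqrt 3]. *)
Lemma sq_form_bound (R : realFieldType) (U V H a e : R) :
  0 <= U -> 0 <= V -> 0 <= H -> 0 <= a -> 0 <= e -> a <= U + H -> e <= V + H ->
  a ^+ 2 + a * e + e ^+ 2 <= (U + V + 7 / 4 * H) ^+ 2.
Proof.
move=> U0 V0 H0 a0 e0 h1 h2.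
have m1 : a * a <= (U + H) * (U + H) by apply: ler_pM.
have m2 : e * e <= (V + H) * (V + H) by apply: ler_pM.
have m3 : a * e <= (U + H) * (V + H) by apply: ler_pM.
have := mulr_ge0 U0 V0; have := mulr_ge0 U0 H0; have := mulr_ge0 V0 H0.
have := mulr_ge0 H0 H0; rewrite !expr2; lra.
Qed.

Section GapToDistance.
Context {R : realType} {m n : nat} (A : 'M[R]_(m, n)) (b : 'cV[R]_m) (c : 'cV[R]_n).
Context (hLP : LP_assumption A b c) (hc : A *m c = 0).

Local Notation Z := ('cV[R]_n * 'cV[R]_m)%type.
Let q := qvec A b.
Let lmin := lambda_min A.
Let lmax := lambda_max A.
Let kap := kappa A.
Let mup := mu_p A b c.
Let mud := mu_d A b c.
Let thp := theta_p A b c.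
Let thd := theta_d A b c.
Let tau := tau_step A b c.
Let sigma := sigma_step A b c.
Let st := Num.sqrt tau.
Let ss := Num.sqrt sigma.
Let D0 := Dist 0 (Xstar A b c).
Let Dc := Dist c (Sstar A b c).
Let nc := enorm c.
Let nq := enorm q.
Local Notation fP := (Mform tau sigma A).
Local Notation fN := (Mform tau sigma (- A)).

(** Distances of the starting point to the primal and dual optima, in the units
    of the step-size norm. *)
Definition opt_radius_p : R := D0 / st.
Definition opt_radius_d : R := Dc / (lmin * ss).

Definition condition_sum : R :=
  thp / mup + thd / mud + D0 / (mud * Dist 0 (Vp A b)) + Dc / (mup * Dist 0 (Vd A c)).

Let Tp := thp / mup.
Let Td := thd / mud.
Let T3 := D0 / (mud * nq).
Let T4 := Dc / (mup * nc).

Lemma condition_sumE : condition_sum = Tp + Td + T3 + T4.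
Proof. by rewrite /condition_sum (Dist0_Vp hLP) (Dist0_Vd hLP hc). Qed.

Let mup0 : 0 < mup. Proof. by have [] := primal_data hLP. Qed.
Let mup1 : mup <= 1. Proof. by have [] := primal_data hLP. Qed.
Let thp1 : 1 <= thp. Proof. by have [] := primal_data hLP. Qed.
Let nc0 : 0 < nc. Proof. by have [_ _ _ /enorm_gt0] := primal_data hLP. Qed.
Let mud0 : 0 < mud. Proof. by have [] := dual_data hLP. Qed.
Let mud1 : mud <= 1. Proof. by have [] := dual_data hLP. Qed.
Let thd1 : 1 <= thd. Proof. by have [] := dual_data hLP. Qed.
Let nq0 : 0 < nq. Proof. by have [_ _ _ /enorm_gt0] := dual_data hLP. Qed.
Let lmin0 : 0 < lmin. Proof. by have [] := singular_data hLP. Qed.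
Let lmax0 : 0 < lmax. Proof. by have [] := singular_data hLP. Qed.
Let kap1 : 1 <= kap. Proof. by have [] := singular_data hLP. Qed.
Let kap0 : 0 < kap. Proof. exact: lt_le_trans kap1. Qed.
Let tau0 : 0 < tau. Proof. by have [] := step_data hLP. Qed.
Let sigma0 : 0 < sigma. Proof. by have [] := step_data hLP. Qed.
Let st0 : 0 < st. Proof. by rewrite sqrtr_gt0. Qed.
Let ss0 : 0 < ss. Proof. by rewrite sqrtr_gt0. Qed.
Let hlam : forall x : 'cV[R]_n, enorm (A *m x) <= lmax * enorm x.
Proof. by have [] := singular_value_bounds (A_neq0 hLP). Qed.
Let hstep : 4 * tau * sigma * lmax ^+ 2 <= 1.
Proof. exact: step_ineq. Qed.
Let stst : st * st = tau. Proof. by rewrite -expr2 sqr_sqrtr // ltW. Qed.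
Let ssss : ss * ss = sigma. Proof. by rewrite -expr2 sqr_sqrtr // ltW. Qed.
Let pP : psd_form fP := Mform_psd_pos tau0 sigma0 hlam hstep.
Let pN : psd_form fN := Mform_psd_opp tau0 sigma0 hlam hstep.

Lemma step_product : (st * ss * lmin)^-1 = 2 * kap.
Proof.
have -> : st * ss = (2 * lmax)^-1.
  have [_ _ e] := step_data hLP.
  rewrite /st /ss -sqrtrM ?ltW // e -/lmax -[4 * _](_ : (2 * lmax) ^+ 2 = _); last by ring.
  by rewrite sqrtrV ?sqr_ge0 // sqrtr_sqr gtr0_norm // mulr_gt0 ?ltr0n.
by rewrite /kap /kappa -/lmin -/lmax; field; rewrite !gt_eqF.
Qed.

Lemma tau_inv : tau^-1 = 2 * kap * (mup * nc) / (mud * nq).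
Proof.
rewrite /tau /tau_step -/q -/kap -/mup -/mud -/nc -/nq.
by field; rewrite !gt_eqF.
Qed.

Lemma sigma_inv : (sigma * lmin * lmin)^-1 = 2 * kap * (mud * nq) / (mup * nc).
Proof.
rewrite /sigma /sigma_step -/q -/mup -/mud -/nc -/nq -/lmin -/lmax /kap /kappa -/lmin -/lmax.
by field; rewrite !gt_eqF.
Qed.

(** The step sizes are chosen so that these four quotients, which appear when
    objective errors are converted into distances, are the last two terms of the
    condition number up to the common factor [2 kappa]. *)
Lemma opt_radius_p_primal : opt_radius_p / (st * (mup * nc)) = 2 * kap * T3.
Proof.
have -> : opt_radius_p / (st * (mup * nc)) = D0 * tau^-1 / (mup * nc).
  by rewrite /opt_radius_p -stst; field; rewrite !gt_eqF.
by rewrite tau_inv /T3; field; rewrite !gt_eqF.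
Qed.

Lemma opt_radius_d_primal : opt_radius_d / (st * (mup * nc)) = 2 * kap * T4.
Proof.
have -> : opt_radius_d / (st * (mup * nc)) = Dc * (st * ss * lmin)^-1 / (mup * nc).
  by rewrite /opt_radius_d; field; rewrite !gt_eqF.
by rewrite step_product /T4; field; rewrite !gt_eqF.
Qed.

Lemma opt_radius_p_dual : opt_radius_p / (lmin * ss * (mud * nq)) = 2 * kap * T3.
Proof.
have -> : opt_radius_p / (lmin * ss * (mud * nq)) = D0 * (st * ss * lmin)^-1 / (mud * nq).
  by rewrite /opt_radius_p; field; rewrite !gt_eqF.
by rewrite step_product /T3; field; rewrite !gt_eqF.
Qed.

Lemma opt_radius_d_dual : opt_radius_d / (lmin * ss * (mud * nq)) = 2 * kap * T4.
Proof.
have -> : opt_radius_d / (lmin * ss * (mud * nq)) = Dc * (sigma * lmin * lmin)^-1 / (mud * nq).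
  by rewrite /opt_radius_d -ssss; field; rewrite !gt_eqF.
by rewrite sigma_inv /T4; field; rewrite !gt_eqF.
Qed.

Let D0_ge : nq <= D0.
Proof.
have [X0 _ _] := hLP; apply: Dist_ge => // x [[Ax _] _]; rewrite /nq /q.
by rewrite -(Dist0_Vp hLP); exact: Dist_le.
Qed.

Let Dc_ge0 : 0 <= Dc. Proof. exact: Dist_ge0. Qed.

Lemma opt_radius_p_gt0 : 0 < opt_radius_p.
Proof. by rewrite divr_gt0 // (lt_le_trans nq0). Qed.

Lemma opt_radius_d_ge0 : 0 <= opt_radius_d.
Proof. by rewrite divr_ge0 // mulr_ge0 // ltW. Qed.

Lemma exists_dual_opt : exists s, Sstar A b c s.
Proof. by have [[xs hxs] _ _] := hLP; exact: (dual_optimum hLP hxs). Qed.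

Lemma Sstar_closest v : exists2 u, Sstar A b c u & Dist v (Sstar A b c) = enorm (v - u).
Proof. by have [s] := exists_dual_opt; rewrite SstarE => /Xstar_closest. Qed.

Lemma Sstar_dual_point (s : 'cV[R]_n) (y : 'cV[R]_m) : Sstar A b c s ->
  exists y', c - A^T *m y' = s /\ lmin * enorm (y - y') <= enorm (c - A^T *m y - s).
Proof.
move=> [[[w _ <-] _] _].
have [|v [hv hb]] := preimage_bound hLP (v := A^T *m (y + w)).
  by exists (y + w).
exists (y - v); split.
  by rewrite mulmxBr hv mulmxDr [A^T *m y + _]addrC opprB addrK.
rewrite opprB addrCA subrr addr0; apply: le_trans hb _.
rewrite mulmxDr -[leLHS]enormN le_eqVlt; apply/orP; left; apply/eqP; congr enorm.
by apply/colP => i; rewrite !mxE; ring.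
Qed.

(** Optima closest to the starting point: the size of the region visited by the
    iterates is measured from them. *)
Lemma reference_saddle : exists x0 y0, [/\ Xstar A b c x0, Sstar A b c (c - A^T *m y0),
  enorm x0 = D0 & lmin * enorm y0 <= Dc].
Proof.
have [[xs hxs] _ _] := hLP; have [x0 hx0 e0] := Xstar_closest hxs 0.
have [s0 hs0 es] := Sstar_closest c.
have [y [hy hb]] := Sstar_dual_point 0 hs0.
exists x0, y; split; rewrite ?hy //; first by rewrite /D0 e0 sub0r enormN.
by move: hb; rewrite sub0r enormN mulmx0 subr0 -es.
Qed.

Lemma saddle_norm x0 y0 : enorm x0 = D0 -> lmin * enorm y0 <= Dc ->
  snorm fN (x0, y0) <= opt_radius_p + opt_radius_d /\ snorm fP (0, y0) <= opt_radius_d /\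
  snorm fP (x0, 0) = opt_radius_p.
Proof.
move=> hx hy; have P0 := ltW opt_radius_p_gt0; have Q0 := opt_radius_d_ge0.
have hy' : enorm y0 / ss <= opt_radius_d.
  rewrite ler_pdivrMr // /opt_radius_d invfM mulrA divfK ?gt_eqF // ler_pdivlMr // mulrC //.
split; last first.
  by rewrite (snormM_snd A tau sigma0) (snormM_fst A sigma tau0) hx.
rewrite -(@ler_pXn2r _ 2) ?nnegrE ?addr_ge0 ?snorm_ge0 //.
apply: (@le_trans _ _ (opt_radius_p ^+ 2
  + opt_radius_p * opt_radius_d + opt_radius_d ^+ 2)); last first.
  by have := mulr_ge0 P0 Q0; rewrite sqrrD; lra.
apply: (oppM_le_coord tau0 sigma0 hlam hstep) => //=.
  by rewrite -enormE hx /opt_radius_p exprMn exprVn [st ^+ 2]expr2 stst mulrC.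
rewrite -enormE; apply: le_trans (_ : (enorm y0 / ss) ^+ 2 <= _).
  by rewrite exprMn exprVn [ss ^+ 2]expr2 ssss mulrC.
by rewrite ler_pXn2r ?nnegrE // divr_ge0 ?enorm_ge0 // ltW.
Qed.

Section Bound.
Context (x0 : 'cV[R]_n) (y0 : 'cV[R]_m) (hx0 : Xstar A b c x0).
Context (hs0 : Sstar A b c (c - A^T *m y0)) (ex0 : enorm x0 = D0).
Context (ey0 : lmin * enorm y0 <= Dc).
Context (z : Z) (r rh : R) (hz : orthant z.1) (r0 : 0 < r).
Context (hgap : gap_bounded A b c tau sigma r rh z).
Context (hr : r <= 7 / 2 * (opt_radius_p + opt_radius_d)).
Context (hzs : snorm fN (z - (x0, y0)) <= opt_radius_p + opt_radius_d).

Let G := 7 / 2 * (opt_radius_p + opt_radius_d).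
Let rh0 : 0 <= rh := gap_bounded_ge0 tau0 sigma0 hlam hstep r0 hz hgap.

Lemma gap_le_radius (zh : Z) : orthant zh.1 -> snorm fP (zh - z) <= G -> gap A b c z zh <= rh * G.
Proof.
move=> hzh hG; apply: le_trans
  (gap_bounded_scale tau0 sigma0 hlam hstep r0 hz hgap hzh) _.
by rewrite ler_wpM2l // ge_max hr.
Qed.

Let near0 : snorm fP (z - (x0, y0)) <= 7 / 4 * (opt_radius_p + opt_radius_d).
Proof.
apply: le_trans (normM_le_oppM tau0 sigma0 hlam hstep _) _.
by rewrite ler_pM2l //; lra.
Qed.

(** The gap towards [(x0, 0)] is exactly the primal objective error. *)
Lemma primal_value : dot c z.1 - dot c x0 <= rh * G.
Proof.
have [_ [hy hx]] := saddle_norm ex0 ey0.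
have [[Ax xx0] _] := hx0.
have -> : dot c z.1 - dot c x0 = gap A b c z (x0, 0).
  rewrite /gap /Lagrangian /= mulmx0 -dot_mulmx Ax.
  by rewrite (form0r (dot_psd m)) (form0r (dot_psd n)); ring.
apply: gap_le_radius => //=; rewrite (snormB pP).
have -> : z - (x0, 0) = (z - (x0, y0)) + (0, y0).
  by rewrite [z]surjective_pairing; congr pair; rewrite /= ?subrK ?addr0 ?subr0.
apply: le_trans (snormD pP _ _) _.
by have := opt_radius_p_gt0; have := opt_radius_d_ge0; move: near0 hy; rewrite /G; lra.
Qed.

(** The gap towards [(0, y0)] exceeds the dual objective error by the product of
    the iterate and an optimal slack. *)
Lemma dual_value :
  dot q (c - A^T *m z.2) - dot q (c - A^T *m y0) <= rh * G.
Proof.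
have [_ [hy hx]] := saddle_norm ex0 ey0.
have [[_ s0] _] := hs0.
apply: (@le_trans _ _ (gap A b c z (0, y0))).
  rewrite !(formBr (dot_psd n)) !(dot_qvec hLP) /gap /Lagrangian /=.
  rewrite !(form0l (dot_psd n)) (form0r (dot_psd n)).
  have := dot_ge0 hz s0; rewrite (formBr (dot_psd n)) (formC (dot_psd n) z.1 c); lra.
apply: gap_le_radius; first exact: orthant0.
rewrite (snormB pP).
have -> : z - (0, y0) = (z - (x0, y0)) + (x0, 0).
  by rewrite [z]surjective_pairing; congr pair; rewrite /= ?subrK ?addr0 ?subr0.
apply: le_trans (snormD pP _ _) _.
by have := opt_radius_p_gt0; have := opt_radius_d_ge0; move: near0; rewrite hx /G; lra.
Qed.

Let dlt := rh / ss / lmin.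

(** Restore [A x = b] along the range of [A^T], at cost [dlt] and without changing
    the objective because [c] is in the null space; then apply the error bound. *)
Lemma primal_distance :
  Dist z.1 (Xstar A b c) <= 3 * Tp * dlt + rh * G / (mup * nc).
Proof.
have [hX hn _] := hLP.
have hres := gap_bounded_primal_residual tau0 sigma0 hlam hstep r0 hz hgap.
(* The projection of [z.1] on the solutions of [A x = b]. *)
pose x := z.1 + A^T *m (pinv (A *m A^T) *m (b - A *m z.1)).
have [[xb [[Axb _] _]] _ _] := hLP.
have Ax : A *m x = b.
  rewrite /x mulmxDr -[b in LHS]Axb -mulmxBr (gram_pinv_range A).
  by rewrite mulmxBr Axb addrC subrK.
have dx : enorm (z.1 - x) <= dlt.
  have [_ _ _ hmin] := singular_value_bounds (A_neq0 hLP).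
  have := hmin (pinv (A *m A^T) *m (b - A *m z.1)); rewrite -/lmin.
  have -> : A^T *m (pinv (A *m A^T) *m (b - A *m z.1)) = x - z.1 by rewrite /x [RHS]addrC addKr.
  rewrite mulmxBr Ax [enorm (x - z.1)]enormB [enorm (b - _)]enormB => h.
  by rewrite /dlt ler_pdivlMr // mulrC; apply: le_trans h hres.
have dlt0 : 0 <= dlt by exact: le_trans (enorm_ge0 _) dx.
have cx : dot c x = dot c z.1.
  by rewrite /x (formDr (dot_psd n)) (dot_c_range hc) addr0.
have hO : Dist x orthant <= dlt.
  by apply: le_trans (Dist_le x hz) _; rewrite enormB.
have hE := LP_error_bound hx0 hc hn Ax; rewrite cx -/thp -/mup -/nc in hE.
apply: le_trans (Dist_triangle z.1 x hX) _.
apply: le_trans (lerD dx hE) _.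
have mi1 : 1 <= mup^-1 by rewrite -invr1 lef_pV2 // posrE.
have thm : 1 <= Tp by rewrite /Tp -[1]mulr1; apply: ler_pM.
have thm' : thp <= Tp by rewrite /Tp ler_peMr // (le_trans _ thp1).
have h1 : thp * (1 + mup^-1) * Dist x orthant <= 2 * Tp * dlt.
  have -> : thp * (1 + mup^-1) = thp + Tp by rewrite mulrDr mulr1.
  apply: ler_pM; rewrite ?Dist_ge0 //; last by lra.
  by move: thp1; lra.
have h2 : (dot c z.1 - dot c x0) / (mup * nc) <= rh * G / (mup * nc).
  by rewrite ler_pM2r ?invr_gt0 ?mulr_gt0 //; exact: primal_value.
have h3 : dlt <= Tp * dlt by rewrite ler_peMl.
by move: h1 h2 h3; lra.
Qed.

Lemma dual_distance :
  Dist (c - A^T *m z.2) (Sstar A b c) <= 2 * Td * (rh / st) + rh * G / (mud * nq).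
Proof.
have [_ _ hn] := hLP; rewrite FdE SstarE in hn.
have hs := hs0; rewrite SstarE in hs.
have hO := gap_bounded_dual_residual tau0 sigma0 hlam hstep r0 hz hgap.
set s := c - A^T *m z.2 in hO *; rewrite -/st in hO.
have Vs : Vp (dual_mx A) (dual_mx A *m c) s.
  by rewrite -VdE; exists (- z.2) => //; rewrite mulmxN.
have hE := LP_error_bound hs (dual_mx_qvec A b) hn Vs.
rewrite -mu_dE -theta_dE -SstarE -/thd -/mud -/q -/nq in hE.
apply: le_trans hE _; apply: lerD.
  have mi1 : 1 <= mud^-1 by rewrite -invr1 lef_pV2 // posrE.
  have thm' : thd <= Td by rewrite /Td ler_peMr // (le_trans _ thd1).
  have -> : thd * (1 + mud^-1) = thd + Td by rewrite mulrDr mulr1.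
  apply: ler_pM; rewrite ?Dist_ge0 //; last by lra.
  by move: thd1; lra.
rewrite ler_pM2r ?invr_gt0 ?mulr_gt0 //; exact: dual_value.
Qed.

Let K := 2 * kap * rh.

Lemma scaled_primal_distance :
  Dist z.1 (Xstar A b c) / st <= K * (3 * Tp + 7 / 2 * (T3 + T4)).
Proof.
rewrite ler_pdivrMr //; apply: le_trans primal_distance _.
rewrite le_eqVlt; apply/orP; left; apply/eqP.
have e1 : dlt = K * st.
  by rewrite /K /dlt -step_product; field; rewrite !gt_eqF.
have e2 : rh * G / (mup * nc) = K * (7 / 2 * (T3 + T4)) * st.
  have -> : K * (7 / 2 * (T3 + T4)) = rh * (7 / 2) * (2 * kap * T3 + 2 * kap * T4).
    by rewrite /K; ring.
  rewrite -opt_radius_p_primal -opt_radius_d_primal /G; field; rewrite !gt_eqF //.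
by rewrite e1 e2; ring.
Qed.

Lemma scaled_dual_distance :
  Dist (c - A^T *m z.2) (Sstar A b c) / (lmin * ss) <= K * (2 * Td + 7 / 2 * (T3 + T4)).
Proof.
have ls : 0 < lmin * ss by rewrite mulr_gt0.
rewrite ler_pdivrMr //; apply: le_trans dual_distance _.
rewrite le_eqVlt; apply/orP; left; apply/eqP.
have e1 : rh / st = K * (lmin * ss).
  by rewrite /K -step_product; field; rewrite !gt_eqF.
have e2 : rh * G / (mud * nq) = K * (7 / 2 * (T3 + T4)) * (lmin * ss).
  have -> : K * (7 / 2 * (T3 + T4)) = rh * (7 / 2) * (2 * kap * T3 + 2 * kap * T4).
    by rewrite /K; ring.
  rewrite -opt_radius_p_dual -opt_radius_d_dual /G; field; rewrite !gt_eqF //.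
by rewrite e1 e2; ring.
Qed.

Lemma condition_terms_ge : [/\ 1 <= Tp, 1 <= Td, 1 <= T3 & 0 <= T4].
Proof.
have mi (u v : R) : 1 <= u -> 0 < v <= 1 -> 1 <= u / v.
  by move=> hu /andP[v0 v1]; rewrite ler_pdivlMr // mul1r (le_trans v1).
split.
- by apply: mi; rewrite ?mup0.
- by apply: mi; rewrite ?mud0.
- rewrite /T3 invfM mulrA mulrAC; apply: mi; rewrite ?mud0 //.
  by rewrite ler_pdivlMr // mul1r.
- by rewrite divr_ge0 // mulr_ge0 // ltW.
Qed.

(** Sharpness of the normalized gap, with the constant that governs the length
    of every restart cycle. *)
Theorem saddle_distance : exists zs, saddle_point A b c zs /\
  snorm fN (z - zs) <= 49 / 4 * kap * condition_sum * rh.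
Proof.
have [[xs hxs] _ _] := hLP; have [x1 hx1 ex] := Xstar_closest hxs z.1.
have [s1 hs1 es] := Sstar_closest (c - A^T *m z.2).
have [y1 [ey hy]] := Sstar_dual_point z.2 hs1.
exists (x1, y1); split; first by apply: saddle_point_of_optima; rewrite ?ey.
have h1 := scaled_primal_distance; have h2 := scaled_dual_distance.
rewrite ex in h1; rewrite es in h2.
have [t1 t2 t3 t4] := condition_terms_ge.
have K0 : 0 <= K by rewrite /K mulr_ge0 // mulr_ge0 ?(ltW kap0) ?ler0n.
set U := K * (3 * Tp); set V := K * (2 * Td); set H := K * (7 / 2 * (T3 + T4)).
have U0 : 0 <= U by rewrite mulr_ge0 //; move: t1; lra.
have V0 : 0 <= V by rewrite mulr_ge0 //; move: t2; lra.
have H0 : 0 <= H by rewrite mulr_ge0 //; move: t3 t4; lra.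
rewrite mulrDr -/U -/H in h1; rewrite mulrDr -/V -/H in h2.
set a := enorm (z.1 - x1) / st in h1.
set e := enorm (c - A^T *m z.2 - s1) / (lmin * ss) in h2.
have a0 : 0 <= a by rewrite divr_ge0 ?enorm_ge0 // ltW.
have e0 : 0 <= e by rewrite divr_ge0 ?enorm_ge0 // mulr_ge0 // ltW.
have hn : snorm fN (z - (x1, y1)) ^+ 2 <= a ^+ 2 + a * e + e ^+ 2.
  apply: (oppM_le_coord tau0 sigma0 hlam hstep) => //=.
    by rewrite -enormE /a exprMn exprVn [st ^+ 2]expr2 stst mulrC.
  rewrite -enormE; apply: (@le_trans _ _ ((enorm (z.2 - y1) / ss) ^+ 2)).
    by rewrite exprMn exprVn [ss ^+ 2]expr2 ssss mulrC.
  rewrite ler_pXn2r ?nnegrE // ?divr_ge0 ?enorm_ge0 ?(ltW ss0) //.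
  rewrite /e invfM mulrA ler_pM2r ?invr_gt0 // ler_pdivlMr // mulrC.
  exact: hy.
apply: (@le_trans _ _ (U + V + 7 / 4 * H)).
  rewrite -(@ler_pXn2r _ 2) ?nnegrE ?snorm_ge0 //; last by move: U0 V0 H0; lra.
  exact: le_trans hn (sq_form_bound U0 V0 H0 a0 e0 h1 h2).
rewrite condition_sumE.
have -> : U + V + 7 / 4 * H = kap * rh * (6 * Tp + 4 * Td + 49 / 4 * (T3 + T4)).
  by rewrite /U /V /H /K; field.
have -> : 49 / 4 * kap * (Tp + Td + T3 + T4) * rh =
  kap * rh * (49 / 4 * (Tp + Td + T3 + T4)) by ring.
apply: ler_wpM2l; first by rewrite mulr_ge0 // ltW.
move: t1 t2; move: Tp Td T3 T4 => B1 B2 B3 B4; lra.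
Qed.

Theorem error_distance : Ed A b c z.1 (c - A^T *m z.2) <=
  Num.max st (lmin * ss) * (7 * kap * condition_sum * rh).
Proof.
have [t1 t2 t3 t4] := condition_terms_ge.
have h1 := scaled_primal_distance; have h2 := scaled_dual_distance.
have ls : 0 < lmin * ss by rewrite mulr_gt0.
set W := 7 * kap * condition_sum * rh.
have WE : W = K * (7 / 2 * (Tp + Td + T3 + T4)).
  by rewrite /W condition_sumE /K; field.
have K0 : 0 <= K by rewrite /K mulr_ge0 // mulr_ge0 ?(ltW kap0) ?ler0n.
have W0 : 0 <= W by rewrite WE mulr_ge0 //; move: t1 t2 t3 t4; lra.
have g1 : Dist z.1 (Xstar A b c) / st <= W.
  by apply: le_trans h1 _; rewrite WE ler_wpM2l //; move: t1 t2; lra.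
have g2 : Dist (c - A^T *m z.2) (Sstar A b c) / (lmin * ss) <= W.
  by apply: le_trans h2 _; rewrite WE ler_wpM2l //; move: t1 t2; lra.
rewrite ler_pdivrMr // mulrC in g1; rewrite ler_pdivrMr // mulrC in g2.
rewrite /Ed ge_max; apply/andP; split.
  by apply: le_trans g1 _; rewrite ler_wpM2r // le_max lexx.
by apply: le_trans g2 _; rewrite ler_wpM2r // le_max lexx orbT.
Qed.

End Bound.
End GapToDistance.

(** * Counting restarts and steps *)
Section Restarts.
Context {R : realType} {m n : nat} (A : 'M[R]_(m, n)) (b : 'cV[R]_m) (c : 'cV[R]_n).

(** The gap towards a point at fraction [t] of the way is linear in [t] but bounded
    by a quadratic in [t], hence nonpositive. *)
Lemma fixed_average_gap (tau sigma lam r : R) (z : 'cV[R]_n * 'cV[R]_m) k :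
  0 < tau -> 0 < sigma -> (forall x : 'cV[R]_n, enorm (A *m x) <= lam * enorm x) ->
  4 * tau * sigma * lam ^+ 2 <= 1 -> (0 < k)%N -> orthant z.1 ->
  pdhg_avg A b c tau sigma z k = z -> gap_bounded A b c tau sigma r 0 z.
Proof.
move=> ht hs hl hst k0 hz hfix zh hzh _; rewrite mulr0.
have pN := Mform_psd_opp ht hs hl hst.
set Q := Mform tau sigma (- A) (zh - z) (zh - z).
have Q0 : 0 <= Q by exact: form_ge0 pN _.
have kp : 0 < k%:R :> R by rewrite ltr0n.
have hb t : 0 < t <= 1 -> 2 * k%:R * gap A b c z zh <= t * Q.
  move=> /andP[t0 t1]; pose zt := z + t *: (zh - z).
  have hzt : orthant zt.1 by apply: orthant_convex; rewrite // (ltW t0).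
  have := pdhg_sum_gap b c ht hs hl hst z hzt k0; rewrite hfix.
  have := form_ge0 pN (zt - iter k (pdhg_step A b c tau sigma) z).
  rewrite gapE /zt [X in grad_gap _ _ _ _ X]addrC [in X in _ <= X - _]addrC.
  rewrite !addKr grad_gapZ -gapE (formZl pN) (formZr pN) -/Q => h1 h2.
  rewrite -(ler_pM2l t0); move: h1 h2; lra.
rewrite leNgt; apply/negP => g0; set g := gap A b c z zh in g0 hb.
have G0 : 0 < 2 * k%:R * g by rewrite !mulr_gt0.
pose t := Num.min 1 (k%:R * g / (Q + 1)).
have t0 : 0 < t by rewrite lt_min ltr01 divr_gt0 ?mulr_gt0 // ltr_wpDl.
have tq : t * (Q + 1) <= k%:R * g.
  by rewrite -ler_pdivlMr ?ltr_wpDl // ge_min lexx orbT.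
have := hb t; rewrite t0 ge_min lexx => /(_ isT).
have : t * Q <= t * (Q + 1) by rewrite ler_pM2l // lerDl.
by move: tq G0; lra.
Qed.

Lemma restart_point_ext (tau sigma : R) z0 ks ks' j : (forall i, (i < j)%N -> ks i = ks' i) ->
  restart_point A b c tau sigma z0 ks j = restart_point A b c tau sigma z0 ks' j.
Proof.
elim: j => [//|j IH] h /=; rewrite h // IH // => i hi; apply: h.
exact: ltnW.
Qed.

Lemma restart_condition_ext (tau sigma beta : R) z0 ks ks' j k :
  (forall i, (i < j)%N -> ks i = ks' i) ->
  restart_condition A b c tau sigma beta z0 ks j k <->
  restart_condition A b c tau sigma beta z0 ks' j k.
Proof.
move=> h; rewrite /restart_condition (restart_point_ext _ _ _ h).
rewrite (@restart_point_ext _ _ _ _ ks' j.-1) // => i hi; apply: h.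
exact: leq_trans hi (leq_pred j).
Qed.

Context (hLP : LP_assumption A b c) (hc : A *m c = 0) (eps : R) (heps : 0 < eps).

Local Notation Z := ('cV[R]_n * 'cV[R]_m)%type.
Let kap := kappa A.
Let tau := tau_step A b c.
Let sigma := sigma_step A b c.
Let st := Num.sqrt tau.
Let ls := lambda_min A * Num.sqrt sigma.
Let D0 := Dist 0 (Xstar A b c).
Let Dc := Dist c (Sstar A b c).
Let S := condition_sum A b c.
Let PQ := opt_radius_p A b c + opt_radius_d A b c.
Let e : R := expR 1.
Let E0 := Ed A b c 0 (c - A^T *m 0).
Local Notation fP := (Mform tau sigma A).
Local Notation fN := (Mform tau sigma (- A)).
Local Notation zj ks j := (restart_point A b c tau sigma ((0, 0) : Z) ks j).
Local Notation err ks j := (restart_error A b c tau sigma ((0, 0) : Z) ks j).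
Local Notation cond ks j k := (restart_condition A b c tau sigma e^-1 ((0, 0) : Z) ks j k).
Local Notation run ks N := (rPDHG_run A b c tau sigma e^-1 ((0, 0) : Z) ks N).

Let tau0 : 0 < tau. Proof. by have [] := step_data hLP. Qed.
Let sigma0 : 0 < sigma. Proof. by have [] := step_data hLP. Qed.
Let hlam : forall x : 'cV[R]_n, enorm (A *m x) <= lambda_max A * enorm x.
Proof. by have [] := singular_value_bounds (A_neq0 hLP). Qed.
Let hstep : 4 * tau * sigma * lambda_max A ^+ 2 <= 1.
Proof. exact: step_ineq. Qed.
Let pP : psd_form fP := Mform_psd_pos tau0 sigma0 hlam hstep.
Let pN : psd_form fN := Mform_psd_opp tau0 sigma0 hlam hstep.
Let e2 : 2 <= e. Proof. by have := @expR_ge1Dx R 1; rewrite /e; lra. Qed.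
Let e0 : 0 < e. Proof. exact: expR_gt0. Qed.
Let kap1 : 1 <= kap. Proof. by have [] := singular_data hLP. Qed.

Let S_ge3 : 3 <= S.
Proof.
have [t1 t2 t3 t4] := condition_terms_ge hLP; rewrite /S (condition_sumE hLP hc).
by move: t1 t2 t3 t4; lra.
Qed.

Let S_ge0 : 0 <= S. Proof. exact: le_trans S_ge3. Qed.
Let kap_ge0 : 0 <= kap. Proof. exact: le_trans kap1. Qed.

Let PQ0 : 0 < PQ. Proof. by rewrite ltr_wpDr ?opt_radius_d_ge0 ?opt_radius_p_gt0. Qed.

Definition pending ks N := run ks N /\ forall j, (j < N)%N -> eps < err ks j.

Section Pending.
Context (x0 : 'cV[R]_n) (y0 : 'cV[R]_m) (hx0 : Xstar A b c x0).
Context (hs0 : Sstar A b c (c - A^T *m y0)) (ex0 : enorm x0 = D0).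
Context (ey0 : lambda_min A * enorm y0 <= Dc).
Context (ks : nat -> nat) (N : nat) (hpend : pending ks N).

Let zs : Z := (x0, y0).
Let hsad : saddle_point A b c zs.
Proof. exact: saddle_point_of_optima. Qed.

Lemma restart_point_orthant j : orthant (zj ks j).1.
Proof. by case: j => [|j] /=; [exact: orthant0|exact: avg_orthant]. Qed.

Let ks_gt0 j : (j < N)%N -> (0 < ks j)%N.
Proof. by move=> hj; have [h _] := hpend; have [] := h j hj. Qed.

Lemma restart_point_near j : (j <= N)%N -> snorm fN (zj ks j - zs) <= PQ.
Proof.
elim: j => [_|j IH hj] /=.
  by rewrite (snormB pN) subr0; have [] := saddle_norm hLP ex0 ey0.
apply: le_trans (IH (ltnW hj)).
apply: (avg_fejer tau0 sigma0 hlam hstep _ hsad); exact: ks_gt0.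
Qed.

Let rad j := normM A tau sigma (zj ks j.+1 - zj ks j).
Let rh j := rho A b c tau sigma (rad j) (zj ks j.+1).

Lemma radius_le j : (j < N)%N -> rad j <= 7 / 2 * PQ.
Proof.
move=> hj; rewrite /rad normME.
apply: le_trans (normM_le_oppM tau0 sigma0 hlam hstep _) _.
have := snorm_triangle pN (zj ks j.+1) zs (zj ks j).
rewrite [snorm fN (zs - _)](snormB pN).
by have := restart_point_near (ltnW hj); have := restart_point_near hj; lra.
Qed.

(** A zero radius means that an average of steps did not move; the previous
    restart point was then a saddle point, of error zero. *)
Lemma radius_gt0 j : (j < N)%N -> 0 < rad j.
Proof.
move=> hj; have := snorm_ge0 fP (zj ks j.+1 - zj ks j); rewrite -normME -/(rad j).
rewrite le_eqVlt => /orP[/eqP r0|//]; have [_ /(_ j hj) herr] := hpend.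
have hfix : zj ks j.+1 = zj ks j.
  apply/eqP; rewrite -subr_eq0; apply/eqP.
  by apply: (snormM_eq0 tau0 sigma0 hlam hstep); rewrite -normME.
have hgap := fixed_average_gap (r := PQ) tau0 sigma0 hlam hstep (ks_gt0 hj)
  (restart_point_orthant j) hfix.
have := error_distance hLP hc hx0 hs0 ex0 ey0 (restart_point_orthant j) PQ0 hgap.
rewrite mulr0 mulr0 => h; have : err ks j <= 0.
  by apply: h; [move: PQ0; rewrite /PQ; lra|exact: restart_point_near (ltnW hj)].
by move=> /(lt_le_trans herr) /(lt_trans heps); rewrite ltxx.
Qed.

Lemma restart_gap j : (j < N)%N -> gap_bounded A b c tau sigma (rad j) (rh j) (zj ks j.+1).
Proof.
by move=> hj zh hzh hr; apply: (gap_le_rho b c tau0 sigma0 hlam hstep (radius_gt0 hj)).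
Qed.

Lemma first_rho : (0 < N)%N -> ks 0%N = 1%N /\ rh 0 <= 21 / 4 * PQ.
Proof.
move=> hN; have [hrun _] := hpend; have [_ hcond _] := hrun 0%N hN.
have k1 : ks 0%N = 1%N by case: hcond => [[_ ->]|[]].
split=> //; apply: (@le_trans _ _ (21 / 4 * snorm fN (zj ks 0 - zs) / (ks 0%N)%:R)).
  by apply: (rho_avg_le tau0 sigma0 hlam hstep _ hsad); rewrite k1.
by rewrite k1 divr1; have := restart_point_near (leq0n N); lra.
Qed.

Lemma rho_decay j : (j < N)%N -> rh j <= 21 / 4 * PQ / e ^+ j.
Proof.
elim: j => [hN|j IH hj]; first by rewrite expr0 divr1; have [] := first_rho hN.
have [hrun _] := hpend; have [_ hcond _] := hrun j.+1 hj.
case: hcond => [[//]|[_ hcond]]; apply: le_trans hcond _.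
have -> : 21 / 4 * PQ / e ^+ j.+1 = e^-1 * (21 / 4 * PQ / e ^+ j).
  by rewrite exprS invfM; ring.
by rewrite ler_pM2l ?invr_gt0 //; exact: IH (ltnW hj).
Qed.

Lemma restart_error_le j : (j < N)%N ->
  err ks j.+1 <= Num.max st ls * (7 * kap * S * (21 / 4 * PQ / e ^+ j)).
Proof.
move=> hj; have := error_distance hLP hc hx0 hs0 ex0 ey0 (restart_point_orthant j.+1)
  (radius_gt0 hj) (restart_gap hj) (radius_le hj) (restart_point_near hj).
move=> /le_trans; apply; apply: ler_wpM2l.
  by rewrite le_max sqrtr_ge0.
apply: ler_wpM2l; last exact: rho_decay.
by rewrite mulr_ge0 ?S_ge0 // mulr_ge0 ?kap_ge0.
Qed.

Let K0 : R := 1029 / 16 * e * kap * S.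

(** Sublinear decay of the gap of the averages against its sharpness: the two
    constants multiply to [21/4 * 49/4 = 1029/16] times [kap * S]. *)
Lemma restart_cond_large j k : (0 < j)%N -> (j <= N)%N -> (0 < k)%N ->
  K0 <= k%:R -> cond ks j k.
Proof.
case: j => // j _ hj k0 hk; right; split=> //.
have [zt [hzt hd]] := saddle_distance hLP hc hx0 hs0 ex0 ey0 (restart_point_orthant j.+1)
  (radius_gt0 hj) (restart_gap hj) (radius_le hj) (restart_point_near hj).
have kp : 0 < k%:R :> R by rewrite ltr0n.
apply: le_trans (rho_avg_le tau0 sigma0 hlam hstep _ hzt k0) _.
have rh0 := gap_bounded_ge0 tau0 sigma0 hlam hstep (radius_gt0 hj)
  (restart_point_orthant j.+1) (restart_gap hj).
rewrite ler_pdivrMr //.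
apply: (@le_trans _ _ (21 / 4 * (49 / 4 * kap * S * rh j))); first by rewrite ler_pM2l //; lra.
have -> : 21 / 4 * (49 / 4 * kap * S * rh j) = e^-1 * rh j * K0.
  by rewrite /K0; field; rewrite gt_eqF.
by apply: ler_wpM2l => //; rewrite mulr_ge0 // invr_ge0 ltW.
Qed.

Let NhatE : Nhat A b c = 16 * kap * S. Proof. by []. Qed.

Let kS3 : 3 <= kap * S.
Proof. by rewrite -[3]mul1r; apply: ler_pM; rewrite ?kap1 ?S_ge3. Qed.

Let ekS6 : 6 <= e * (kap * S).
Proof.
have -> : 6 = 2 * 3 :> R by ring.
by apply: ler_pM.
Qed.

(** The restart fails one step before the last, which bounds the length by
    [K0 + 1]; the gap between 1029/16 and 80 absorbs the 1. *)
Lemma restart_length j : (0 < j < N)%N -> (ks j)%:R <= 5 * e * Nhat A b c.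
Proof.
move=> /andP[j0 hj]; have -> : 5 * e * Nhat A b c = 80 * (e * (kap * S)) by rewrite NhatE; ring.
have [hrun _] := hpend; have [kj _ hmin] := hrun j hj.
have [k1|k2] := leqP (ks j) 1.
  have : (ks j)%:R <= 1 :> R by rewrite -[1]/(1%:R) ler_nat.
  by move: ekS6; lra.
have kp : (0 < (ks j).-1 < ks j)%N by rewrite -subn1 subn_gt0 k2 ltn_subrL kj.
have hlt : (ks j).-1%:R < K0.
  rewrite ltNge; apply/negP => h; apply: (hmin _ kp).
  by apply: restart_cond_large => //; [exact: ltnW|case/andP: kp].
have -> : (ks j)%:R = (ks j).-1%:R + 1 :> R by rewrite natr1 prednK.
have : K0 = 1029 / 16 * (e * (kap * S)) by rewrite /K0; ring.
by move: hlt ekS6; lra.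
Qed.

Lemma pending_extend : eps < err ks N -> exists ks', pending ks' N.+1.
Proof.
move=> hN; have [k [k0 hk]] : exists k, (0 < k)%N /\ cond ks N k.
  have [->|N0] := posnP N; first by exists 1%N; split=> //; left.
  exists (Num.bound K0).+1; split=> //; apply: restart_cond_large => //.
  have K00 : 0 <= K0.
    have -> : K0 = 1029 / 16 * (e * (kap * S)) by rewrite /K0; ring.
    by move: ekS6; lra.
  by apply: ltW; apply: lt_trans (archi_boundP K00) _; rewrite ltr_nat.
have exk : exists k, (0 < k)%N && `[< cond ks N k >].
  by exists k; rewrite k0; apply/asboolP.
have [k' /andP[k'0 /asboolP hk'] hmin] := ex_minnP exk.
pose ks' i := if i == N then k' else ks i.
have ext j : (j <= N)%N -> forall i, (i < j)%N -> ks' i = ks i.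
  by move=> hj i hi; rewrite /ks' ltn_eqF // (leq_trans hi).
have ks'N : ks' N = k' by rewrite /ks' eqxx.
have [h1 h2] := hpend; exists ks'; split=> j.
  rewrite ltnS leq_eqVlt => /orP[/eqP ->|hj].
    rewrite ks'N; split=> //.
      by apply/(restart_condition_ext _ _ _ _ _ (ext N (leqnn N))).
    move=> l /andP[l0 hl] /(restart_condition_ext _ _ _ _ _ (ext N (leqnn N))) hc'.
    have := hmin l; rewrite l0 => /(_ (introT (asboolP _) hc')).
    by rewrite leqNgt hl.
  have [g1 g2 g3] := h1 j hj; have eE := ext j (ltnW hj).
  rewrite (ext N (leqnn N) j hj); split=> //.
    exact/(restart_condition_ext _ _ _ _ _ eE).
  by move=> l hl /(restart_condition_ext _ _ _ _ _ eE); exact: g3.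
rewrite ltnS leq_eqVlt => /orP[/eqP ->|hj]; rewrite /restart_error.
  by rewrite (restart_point_ext _ _ _ (ext N (leqnn N))).
by rewrite (restart_point_ext _ _ _ (ext j (ltnW hj))); exact: h2.
Qed.

Let X := Nhat A b c * Dhat A b c * (E0 / eps).

Lemma step_ratio : [/\ 0 < st, 0 < ls &
  st / ls = mu_d A b c * enorm (qvec A b) / (mu_p A b c * enorm c)].
Proof.
have st0 : 0 < st by rewrite sqrtr_gt0.
have [l0 _ L0 _] := singular_data hLP.
have s0 : 0 < Num.sqrt sigma by rewrite sqrtr_gt0.
have ls0 : 0 < ls by rewrite mulr_gt0.
split=> //.
have [mp _ _ /enorm_gt0 c0] := primal_data hLP; have [md _ _ /enorm_gt0 q0] := dual_data hLP.
have h1 := step_product hLP; have h2 := tau_inv hLP.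
rewrite -/tau -/sigma -/st -/kap in h1 h2.
have stt : tau = st * st by rewrite -expr2 sqr_sqrtr // ltW.
have k0 : 0 < kap by apply: lt_le_trans kap1.
have -> : st / ls = st * st * (st * Num.sqrt sigma * lambda_min A)^-1.
  by rewrite /ls; field; rewrite !gt_eqF.
by rewrite h1 -stt -[tau]invrK h2; field; rewrite !gt_eqF.
Qed.

Let W := Num.max (mu_p A b c * enorm c / (mu_d A b c * normQ A b))
          (mu_d A b c * normQ A b / (mu_p A b c * enorm c)).

(** [W] is the larger of [st / ls] and its inverse: it measures the mismatch
    between the primal and the dual units of length. *)
Lemma balance_ge : [/\ 1 <= W, st / ls <= W & ls / st <= W].
Proof.
have [st0 ls0 wE] := step_ratio.
have WE : W = Num.max (ls / st) (st / ls).
  by rewrite wE -[ls / st]invrK invfM invrK [_ * st]mulrC wE invfM invrK mulrC /W.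
have h1 : ls / st <= W by rewrite WE le_max lexx.
have h2 : st / ls <= W by rewrite WE le_max lexx orbT.
split=> //; have [h|h] := leP st ls.
  by apply: le_trans h1; rewrite ler_pdivlMr // mul1r.
by apply: le_trans h2; rewrite ler_pdivlMr // mul1r ltW.
Qed.

Lemma Nhat_Dhat_ge : 512 * (e * (kap * S) * W) <= Nhat A b c * Dhat A b c.
Proof.
have -> : Nhat A b c * Dhat A b c = kap * (512 * (e * (kap * S) * W)).
  by rewrite NhatE /Dhat -/W -/e -/kap; ring.
have [W1 _ _] := balance_ge.
rewrite ler_peMl // mulr_ge0 // mulr_ge0 //; last by move: W1; lra.
by move: ekS6; lra.
Qed.

Lemma opt_radius_le : Num.max st ls * PQ <= 2 * W * E0.
Proof.
have [st0 ls0 _] := step_ratio; have [W1 W2 W3] := balance_ge.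
have hD0 : D0 <= E0 by rewrite /E0 /Ed le_max lexx.
have hDc : Dc <= E0 by rewrite /E0 /Ed le_max mulmx0 subr0 lexx orbT.
have D00 : 0 <= D0 by exact: Dist_ge0.
have Dc0 : 0 <= Dc by exact: Dist_ge0.
have W0 : 0 <= W by move: W1; lra.
have hM (u : R) : 0 < u -> st / u <= W -> ls / u <= W -> Num.max st ls / u <= W.
  by move=> u0 h1 h2; rewrite ler_pdivrMr // ge_max -!ler_pdivrMr // h1 h2.
have p1 : Num.max st ls * opt_radius_p A b c <= W * E0.
  rewrite /opt_radius_p -/D0 -/st mulrA mulrAC; apply: ler_pM => //.
    by rewrite divr_ge0 ?(ltW st0) // le_max ltW.
  by apply: hM => //; rewrite divff ?gt_eqF.
have p2 : Num.max st ls * opt_radius_d A b c <= W * E0.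
  rewrite /opt_radius_d -/Dc -/ls mulrA mulrAC; apply: ler_pM => //.
    by rewrite divr_ge0 ?(ltW ls0) // le_max ltW.
  by apply: hM => //; rewrite divff ?gt_eqF.
by rewrite /PQ mulrDr; lra.
Qed.

(** The error at the restart point [N - 1] exceeds [eps] but has decayed
    geometrically. *)
Lemma pending_bound : (1 < N)%N -> N.-1%:R < ln X.
Proof.
move=> hN; have [_ herr] := hpend; pose j := N.-2.
have Nj : N = j.+2 by rewrite /j; case: N hN => [|[|]].
rewrite Nj /=; have hj : (j < N)%N by rewrite Nj.
have heps1 : eps < err ks j.+1 by apply: herr; rewrite Nj.
have h2 := restart_error_le hj; have h3 := opt_radius_le; have h4 := Nhat_Dhat_ge.
have ej0 : 0 < e ^+ j by rewrite exprn_gt0.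
have E00 : 0 <= E0 by rewrite /E0 /Ed le_max Dist_ge0.
have [W1 _ _] := balance_ge.
have kS0 : 0 <= kap * S by rewrite mulr_ge0.
have h5 : eps * e ^+ j.+1 < Nhat A b c * Dhat A b c * E0.
  apply: (@lt_le_trans _ _ (err ks j.+1 * e ^+ j.+1)); first by rewrite ltr_pM2r ?exprn_gt0.
  apply: (@le_trans _ _ (147 / 4 * (kap * S) * e * (Num.max st ls * PQ))).
    apply: le_trans (ler_wpM2r _ h2) _; first by rewrite exprn_ge0 // ltW.
    by rewrite le_eqVlt exprS; apply/orP; left; apply/eqP; field; rewrite gt_eqF.
  apply: (@le_trans _ _ (147 / 4 * (kap * S) * e * (2 * W * E0))).
    apply: ler_wpM2l => //; rewrite mulr_ge0 ?(ltW e0) // mulr_ge0 //; lra.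
  apply: le_trans (ler_wpM2r E00 h4).
  have -> : 147 / 4 * (kap * S) * e * (2 * W * E0) = 147 / 2 * (e * (kap * S) * W) * E0.
    by field.
  apply: ler_wpM2r => //; set v := _ * W.
  suff : 0 <= v by lra.
  by rewrite /v mulr_ge0 ?(le_trans _ W1) // mulr_ge0 ?(ltW e0).
have h6 : e ^+ j.+1 < X by rewrite /X mulrA ltr_pdivlMr // mulrC.
have -> : j.+1%:R = ln (e ^+ j.+1) :> R by rewrite lnXn // /e expRK.
by rewrite ltr_ln // posrE ?exprn_gt0 // (lt_trans _ h6) // exprn_gt0.
Qed.

Lemma ln_accuracy_ge0 : (0 < N)%N -> 0 <= ln X.
Proof.
move=> hN; have [_ /(_ 0%N hN) herr] := hpend.
have [W1 _ _] := balance_ge; apply: ln_ge0.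
have hE : 1 <= E0 / eps by rewrite ler_pdivlMr // mul1r ltW.
rewrite /X -[1]mulr1; apply: ler_pM => //; apply: le_trans Nhat_Dhat_ge.
have : 1 <= e * (kap * S) * W by rewrite -[1]mulr1; apply: ler_pM => //; move: ekS6; lra.
by lra.
Qed.

Lemma pending_steps : (\sum_(j < N) ks j)%:R <= Num.max 0 (5 * e * Nhat A b c * ln X + 1).
Proof.
have [->|N0] := posnP N; first by rewrite big_ord0 le_max lexx.
rewrite le_max; apply/orP; right.
have N5 : 0 <= 5 * e * Nhat A b c.
  have -> : 5 * e * Nhat A b c = 80 * (e * (kap * S)) by rewrite NhatE; ring.
  by move: ekS6; lra.
have [k1 _] := first_rho N0.
rewrite -(big_mkord xpredT) big_ltn // k1 natrD addrC lerD2r.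
rewrite natr_sum.
apply: (@le_trans _ _ (\sum_(1 <= j < N) 5 * e * Nhat A b c)).
  by rewrite big_nat_cond [leRHS]big_nat_cond; apply: ler_sum => j; rewrite andbT => /restart_length.
rewrite sumr_const_nat subn1 -[leLHS]mulr_natr; apply: ler_wpM2l => //.
have [N1|N1] := leqP N 1; last exact: ltW (pending_bound N1).
by rewrite (_ : N = 1%N) ?ln_accuracy_ge0 //; apply/eqP; rewrite eqn_leq N1.
Qed.

End Pending.

(** A run that stays above the accuracy can be extended, but not beyond the
    logarithmic bound. *)
Theorem restarts_reach_accuracy : exists2 T : nat,
    rPDHG_iterations A b c tau sigma e^-1 (0, 0) eps T
  & T%:R <= Num.max 0 (5 * e * Nhat A b c * ln (Nhat A b c * Dhat A b c * (E0 / eps)) + 1).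
Proof.
have [x0 [y0 [hx0 hs0 ex0 ey0]]] := reference_saddle hLP.
have step ks N : pending ks N -> err ks N <= eps \/ exists ks', pending ks' N.+1.
  move=> hp; have [h|h] := leP (err ks N) eps; [by left|right].
  exact: (pending_extend hx0 hs0 ex0 ey0 hp).
suff [ks [N [hp hN]]] : exists ks N, pending ks N /\ err ks N <= eps.
  exists (\sum_(j < N) ks j)%N; last exact: (pending_steps hx0 hs0 ex0 ey0 hp).
  by exists ks, N; have [h1 h2] := hp; split.
apply: contrapT => hno.
have all N : exists ks, pending ks N.
  elim: N => [|N [ks hp]]; first by exists (fun=> 0%N); split.
  by have [h|//] := step ks N hp; exfalso; apply: hno; exists ks, N.
pose X := Nhat A b c * Dhat A b c * (E0 / eps).
pose M := (Num.bound `|ln X|).+2.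
have [ks hp] := all M.
have := pending_bound hx0 hs0 ex0 ey0 hp (isT : (1 < M)%N).
rewrite -/X /M /= => hlt; have := archi_boundP (normr_ge0 (ln X)).
have := ler_norm (ln X); have : (Num.bound `|ln X|)%:R <= (Num.bound `|ln X|).+1%:R :> R.
  by rewrite ler_nat.
by move: hlt; lra.
Qed.

End Restarts.

(** * The iteration bound *)

(* Some T exists, i.e. the run does reach accuracy eps, and T is determined by
   rPDHG_iterations.  The maximum with 0 only matters when eps is so large that
   the logarithmic bound is negative; it then asserts T = 0. *)
Theorem theorem3p2 (R : realType) (m n : nat)
    (A : 'M[R]_(m, n)) (b : 'cV[R]_m) (c : 'cV[R]_n)
    (hLP : LP_assumption A b c) (hc : A *m c = 0)
    (eps : R) (heps : 0 < eps) :
  exists2 T : nat,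
    rPDHG_iterations A b c (tau_step A b c) (sigma_step A b c)
      (expR 1)^-1 (0, 0) eps T
  & T%:R <= Num.max 0
      (5 * expR 1 * Nhat A b c
         * ln (Nhat A b c * Dhat A b c
               * (Ed A b c 0 (c - A^T *m 0) / eps)) + 1).
Proof. exact: restarts_reach_accuracy. Qed.
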